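(* Let $\Delta=\bigsqcup_{i=1}^m \Delta_i$ be an $m$-regular partition of a finite irreducible root system $\Delta$ into $m\ge 3$ parts. Then: 1. $\Delta$ is necessarily of type $A_n$, $n\ge 2$. 2. Up to swapping positive and negative roots, re-numbering the elements $\Delta_i$ of the partition, and the action of the Weyl group $W(A_n)$, there is a unique maximal $(n+1)$-regular partition of $A_n$, with parts $$\Delta_i=\{-\beta_i+\beta_j \mid 0\le j\le n,\ j\neq i\},\qquad 0\le i\le n,$$ where $\beta_0=0$, $\beta_i=\alpha_1+\dots+\alpha_i$ for $1\le i\le n$, and $\pi=\{\alpha_1,\dots,\alpha_n\}$ are the simple roots of $\Delta$. 3. Up to the equivalences mentioned in item 2, any other $m$-regular partition (with $m<n+1$) is obtained from the maximal one in item 2 by combining several of its subsets $\Delta_i$ together. 4. Up to the equivalences mentioned in item 2, all $m$-regular partitions are described by $m$-partitions $\lambda=(\lambda_1,\dots,\lambda_m)$ of $n+1$.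
   Context: Root systems here are the root systems of finite-dimensional simple Lie algebras over an algebraically closed field of characteristic $0$. A subset $S\subseteq\Delta$ is closed if $\alpha,\beta\in S$ and $\alpha+\beta\in\Delta$ imply $\alpha+\beta\in S$. An $m$-regular partition of $\Delta$ is a partition $\Delta=\bigsqcup_{i=1}^m\Delta_i$ into $m$ nonempty subsets such that all $\Delta_i$ and all $\Delta_i\sqcup\Delta_j$ ($i\ne j$) are closed. In type $A_n$ the simple roots $\alpha_1,\dots,\alpha_n$ are numbered consecutively along the Dynkin diagram. Swapping positive and negative roots means replacing every part $\Delta_i$ by $-\Delta_i$. Combining several parts means replacing them by their disjoint union. An $m$-partition of $n+1$ is a partition of the integer $n+1$ into $m$ positive integer parts $\lambda_1,\dots,\lambda_m$ (an integer partition, so the order of the parts is immaterial). Throughout, $m\ge 3$. *)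

(* Defs.v *)
From mathcomp Require Import all_boot all_order all_algebra finmap.

Set Implicit Arguments.
Unset Strict Implicit.
Unset Printing Implicit Defensive.

Import Order.TTheory GRing.Theory Num.Theory.
Local Open Scope fset_scope.
Local Open Scope ring_scope.

Definition dot (R : rcfType) (r : nat) (u v : 'rV[R]_r) : R :=
  \sum_(i < r) u 0 i * v 0 i.

Definition cartan (R : rcfType) (r : nat) (b a : 'rV[R]_r) : R :=
  2 * dot b a / dot a a.

Definition reflection (R : rcfType) (r : nat) (a x : 'rV[R]_r) : 'rV[R]_r :=
  x - cartan x a *: a.

(* Reduced and crystallographic. *)
Record root_system (R : rcfType) (r : nat) (D : {fset 'rV[R]_r}) : Prop :=
  RootSystem {
    rs_span : (<<enum_fset D>> = fullv)%VS;
    rs_nonzero : 0 \notin D;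
    rs_reflection : forall a b, a \in D -> b \in D -> reflection a b \in D;
    rs_integral : forall a b, a \in D -> b \in D ->
      exists z : int, cartan b a = z%:~R;
    rs_reduced : forall a (c : R), a \in D -> c *: a \in D -> c = 1 \/ c = -1
  }.

Definition irreducible (R : rcfType) (r : nat) (D : {fset 'rV[R]_r}) : Prop :=
  D <> fset0 /\
  forall A B : {fset 'rV[R]_r}, A `|` B = D ->
    (forall a b, a \in A -> b \in B -> dot a b = 0) ->
    A = fset0 \/ B = fset0.

(* An element of the Weyl group is a product of reflections in roots;
   reflections are involutions, so inverses need not be added. *)
Definition weyl (R : rcfType) (r : nat) (D : {fset 'rV[R]_r})
    (w : 'rV[R]_r -> 'rV[R]_r) : Prop :=
  exists s : seq 'rV[R]_r, {subset s <= D} /\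
    forall x, w x = foldr (@reflection R r) x s.

Definition root_base (R : rcfType) (r : nat) (D : {fset 'rV[R]_r})
    (n : nat) (alpha : n.-tuple 'rV[R]_r) : Prop :=
  [/\ {subset alpha <= D},
      basis_of fullv alpha
    & forall b, b \in D -> exists k : 'I_n -> int,
        b = \sum_(i < n) tnth alpha i *~ k i /\
        ((forall i, 0 <= k i) \/ (forall i, k i <= 0))].

(* Simple roots with Dynkin diagram A_n, numbered consecutively along it:
   tnth alpha i is the simple root usually written alpha_(i+1). *)
Definition typeA_base (R : rcfType) (r : nat) (D : {fset 'rV[R]_r})
    (n : nat) (alpha : n.-tuple 'rV[R]_r) : Prop :=
  root_base D alpha /\
  forall i j : 'I_n, cartan (tnth alpha i) (tnth alpha j) =
    if i == j then 2
    else if (i.+1 == j :> nat) || (j.+1 == i :> nat) then -1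
    else 0.

Definition of_typeA (R : rcfType) (r : nat) (D : {fset 'rV[R]_r})
    (n : nat) : Prop :=
  exists alpha : n.-tuple 'rV[R]_r, typeA_base D alpha.

Definition closed_in (R : rcfType) (r : nat) (D S : {fset 'rV[R]_r}) : Prop :=
  forall a b, a \in S -> b \in S -> a + b \in D -> a + b \in S.

Record regular (R : rcfType) (r : nat) (D : {fset 'rV[R]_r})
    (m : nat) (P : 'I_m -> {fset 'rV[R]_r}) : Prop := Regular {
  reg_cover : forall x, x \in D <-> exists i, x \in P i;
  reg_disjoint : forall i j, i != j -> [disjoint P i & P j];
  reg_nonempty : forall i, P i != fset0;
  reg_closed1 : forall i, closed_in D (P i);
  reg_closed2 : forall i j, i != j -> closed_in D (P i `|` P j)
}.

(* Equivalence up to re-numbering (s), the Weyl group (w), and swapping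
   positive and negative roots (e = true).  These operations commute, so one
   of each suffices.  The index ranges may differ a priori; s forces m = p. *)
Definition equivalent (R : rcfType) (r : nat) (D : {fset 'rV[R]_r})
    (m p : nat) (P : 'I_m -> {fset 'rV[R]_r})
    (Q : 'I_p -> {fset 'rV[R]_r}) : Prop :=
  exists (s : 'I_m -> 'I_p) (w : 'rV[R]_r -> 'rV[R]_r) (e : bool),
    [/\ bijective s, weyl D w
      & forall i, Q (s i) = [fset (-1) ^+ e *: w x | x in P i]].

Definition refines (R : rcfType) (r m p : nat)
    (Q : 'I_p -> {fset 'rV[R]_r}) (P : 'I_m -> {fset 'rV[R]_r}) : Prop :=
  forall k, exists i, Q k `<=` P i.

(* A refinement with the same number of parts is a re-numbering. *)
Definition maximal_regular (R : rcfType) (r : nat) (D : {fset 'rV[R]_r})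
    (m : nat) (P : 'I_m -> {fset 'rV[R]_r}) : Prop :=
  regular D P /\
  forall p (Q : 'I_p -> {fset 'rV[R]_r}),
    regular D Q -> refines Q P -> p = m.

Definition beta (R : rcfType) (r n : nat) (alpha : n.-tuple 'rV[R]_r)
    (i : 'I_n.+1) : 'rV[R]_r :=
  \sum_(k < n | (k < i)%N) tnth alpha k.

Definition max_part (R : rcfType) (r n : nat) (alpha : n.-tuple 'rV[R]_r)
    (i : 'I_n.+1) : {fset 'rV[R]_r} :=
  [fset - beta alpha i + beta alpha j | j in 'I_n.+1 & j != i].

Definition combine (R : rcfType) (r p m : nat) (f : 'I_p -> 'I_m)
    (P : 'I_p -> {fset 'rV[R]_r}) (k : 'I_m) : {fset 'rV[R]_r} :=
  \bigcup_(i <- enum 'I_p | f i == k) P i.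

(* Integer partitions are encoded as weakly decreasing sequences. *)
Definition int_partition (m N : nat) (lambda : seq nat) : bool :=
  [&& size lambda == m, sorted geq lambda, all (leq 1) lambda
    & sumn lambda == N].

(* P is equivalent to a combination, along f, of the maximal partition, in
   which the numbers of combined parts are the entries of lambda. *)
Definition has_shape (R : rcfType) (r : nat) (D : {fset 'rV[R]_r})
    (n : nat) (alpha : n.-tuple 'rV[R]_r) (m : nat)
    (P : 'I_m -> {fset 'rV[R]_r}) (lambda : seq nat) : Prop :=
  exists f : 'I_n.+1 -> 'I_m,
    perm_eq lambda [seq #|[set i | f i == k]| | k <- enum 'I_m] /\
    equivalent D P (combine f (max_part alpha)).

(* Main.v *)
Require Import Defs.
From mathcomp Require Import fingroup perm zify ring lra.
From mathcomp Require Import all_boot all_order all_algebra finmap.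

(** Colour every root by the index of its part. Regularity says exactly that
    the colour of a sum of two roots, when it is a root, is the colour of one of
    the summands, and there are at least three colours.

    Call a root black if it and its opposite have different colours. A black
    root x has the type (colour of x, colour of -x). Two non-orthogonal black
    roots of different types span an A2 whose hexagon carries three colours, and
    irreducibility yields such a pair. Propagating equality of lengths along
    non-orthogonal roots then shows that all roots have the same length.

    Next consider families of vectors e_a with all differences e_a - e_b roots
    of a colour depending only on a, with three colours occurring. A root z not
    orthogonal to such a family, and not one of its differences, takes two
    consecutive values on it. If one value is taken once, z enlarges the family
    by a new vector; otherwise z generates a D4 with some of the e_a, and its
    colours are incompatible. So a maximal family exhausts the root system,
    which is therefore of type A, and its parts are unions of the rows
    {e_a - e_b : b <> a}. The e_a are unique up to translation, sign and
    numbering, whence the remaining assertions. *)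

Set Implicit Arguments.
Unset Strict Implicit.
Unset Printing Implicit Defensive.

Import Order.TTheory GRing.Theory Num.Theory.
Local Open Scope fset_scope.
Local Open Scope ring_scope.

(** * Root systems *)

Section DotProduct.

Variables (R : rcfType) (r : nat).
Implicit Types (x y z : 'rV[R]_r) (c : R).

Lemma dotC x y : dot x y = dot y x.
Proof. by apply: eq_bigr => i _; rewrite mulrC. Qed.

Lemma dotDl x y z : dot (x + y) z = dot x z + dot y z.
Proof. by rewrite /dot -big_split; apply: eq_bigr => i _; rewrite mxE mulrDl. Qed.

Lemma dotZl c x y : dot (c *: x) y = c * dot x y.
Proof. by rewrite /dot mulr_sumr; apply: eq_bigr => i _; rewrite mxE mulrA. Qed.

Lemma dotNl x y : dot (- x) y = - dot x y.
Proof. by rewrite -scaleN1r dotZl mulN1r. Qed.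

Lemma dotBl x y z : dot (x - y) z = dot x z - dot y z.
Proof. by rewrite dotDl dotNl. Qed.

Lemma dot0l x : dot 0 x = 0.
Proof. by rewrite -(scale0r 0) dotZl mul0r. Qed.

Lemma dot_suml (I : Type) (s : seq I) (P : pred I) (F : I -> 'rV[R]_r) z :
  dot (\sum_(i <- s | P i) F i) z = \sum_(i <- s | P i) dot (F i) z.
Proof.
exact: (big_morph (fun x => dot x z) (fun x y => dotDl x y z) (dot0l z)).
Qed.

Lemma dotDr x y z : dot z (x + y) = dot z x + dot z y.
Proof. by rewrite !(dotC z) dotDl. Qed.

Lemma dotNr x y : dot x (- y) = - dot x y.
Proof. by rewrite !(dotC x) dotNl. Qed.

Lemma dotBr x y z : dot z (x - y) = dot z x - dot z y.
Proof. by rewrite !(dotC z) dotBl. Qed.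

Lemma dotZr c x y : dot x (c *: y) = c * dot x y.
Proof. by rewrite !(dotC x) dotZl. Qed.

Definition dotE :=
  (dotDl, dotDr, dotBl, dotBr, dotNl, dotNr, dotZl, dotZr).

Lemma dot_gt0 x : x != 0 -> 0 < dot x x.
Proof.
move=> x0; rewrite lt_def sumr_ge0 ?andbT => [|i _]; last by rewrite -expr2 sqr_ge0.
apply: contra x0; rewrite psumr_eq0 => [/allP h|i _]; last by rewrite -expr2 sqr_ge0.
apply/eqP/rowP => i; have := h i (mem_index_enum i).
by rewrite mulf_eq0 orbb mxE => /eqP.
Qed.

Lemma cartanD x y z : cartan (x + y) z = cartan x z + cartan y z.
Proof. by rewrite /cartan dotDl mulrDr mulrDl. Qed.

Lemma cartanN x z : cartan (- x) z = - cartan x z.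
Proof. by rewrite /cartan dotNl mulrN mulNr. Qed.

Lemma cartan_dot x z : z != 0 -> cartan x z * dot z z = 2 * dot x z.
Proof. by move=> z0; rewrite /cartan divfK // gt_eqF ?dot_gt0. Qed.

Lemma reflection_norm x z : z != 0 ->
  dot (reflection z x) (reflection z x) = dot x x.
Proof.
move=> z0; rewrite /reflection !dotE (dotC z x).
have := cartan_dot x z0; set c := cartan x z => h.
apply/eqP; rewrite -subr_eq0; apply/eqP.
transitivity (c * (c * dot z z - 2 * dot x z)); first by ring.
by rewrite h subrr mulr0.
Qed.

Lemma cartanZ c x z : cartan (c *: x) z = c * cartan x z.
Proof. by rewrite /cartan dotZl !mulrA (mulrC 2). Qed.

Lemma cartan_diag z : z != 0 -> cartan z z = 2.
Proof. by move=> z0; rewrite /cartan mulfK // gt_eqF ?dot_gt0. Qed.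

Lemma reflectionZ z c x : reflection z (c *: x) = c *: reflection z x.
Proof. by rewrite /reflection cartanZ scalerBr scalerA. Qed.

Lemma reflectionK z : z != 0 -> involutive (@reflection R r z).
Proof.
move=> z0 x; rewrite {1}/reflection {2}/reflection cartanD cartanN cartanZ.
rewrite cartan_diag // /reflection.
by rewrite (_ : _ - _ * 2 = - cartan x z) ?scaleNr ?opprK ?subrK //; ring.
Qed.

End DotProduct.

Section RootSystem.

Variables (R : rcfType) (r : nat) (D : {fset 'rV[R]_r}).
Hypothesis hD : root_system D.
Implicit Types (a b x y z : 'rV[R]_r).

Lemma root_neq0 a : a \in D -> a != 0.
Proof. by move=> aD; apply: contraTneq aD => ->; apply: rs_nonzero hD. Qed.

Lemma root_norm_gt0 a : a \in D -> 0 < dot a a.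
Proof. by move=> /root_neq0 /dot_gt0. Qed.

Lemma root_opp a : a \in D -> - a \in D.
Proof.
move=> aD; have := rs_reflection hD aD aD.
rewrite /reflection /cartan mulfK ?gt_eqF ?root_norm_gt0 //.
by rewrite scaler_nat mulr2n opprD addrA subrr add0r.
Qed.

Lemma root_oppE a : (- a \in D) = (a \in D).
Proof. by apply/idP/idP => /root_opp; rewrite ?opprK. Qed.

(** The vector [u] is a multiple of the component of [b] orthogonal to [a]. As [D] is reduced, [u]
    is not zero, and positivity of its norm is the strict inequality. *)
Lemma root_cauchy_schwarz a b : a \in D -> b \in D -> a != b -> a != - b ->
  dot a b ^+ 2 < dot a a * dot b b.
Proof.
move=> aD bD anb anNb; have a0 := root_norm_gt0 aD.
pose u := dot a a *: b - dot a b *: a.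
have u0 : u != 0.
  apply/eqP => /subr0_eq e.
  have eb : b = (dot a b / dot a a) *: a.
    by rewrite mulrC -scalerA -e scalerA mulVf ?scale1r ?gt_eqF.
  have := bD; rewrite eb => /(rs_reduced hD aD) [e1|e1]; move: eb; rewrite e1.
    by rewrite scale1r => eb; rewrite eb eqxx in anb.
  by rewrite scaleN1r => eb; rewrite eb opprK eqxx in anNb.
have := dot_gt0 u0; rewrite /u !dotE (dotC b a).
rewrite (_ : _ + _ = dot a a * (dot a a * dot b b - dot a b ^+ 2)); last by ring.
by rewrite pmulr_rgt0 // subr_gt0.
Qed.

(* The product of the two Cartan integers is 4 cos^2 of the angle, hence < 4. *)
Lemma cartan_lt0 a b : a \in D -> b \in D -> dot a b < 0 -> a + b != 0 ->
  (cartan a b = -1 \/ cartan b a = -1) /\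
  [\/ cartan a b = -1, cartan a b = -2 | cartan a b = -3].
Proof.
move=> aD bD ab0 anb.
have a0 := root_norm_gt0 aD; have b0 := root_norm_gt0 bD.
have neq : a != b.
  by apply: contraTneq ab0 => <-; rewrite -leNgt ltW.
have := root_cauchy_schwarz aD bD neq; rewrite -addr_eq0 => /(_ anb) cs.
have [k hk] := rs_integral hD bD aD; have [l hl] := rs_integral hD aD bD.
have ck := cartan_dot a (root_neq0 bD); have cl := cartan_dot b (root_neq0 aD).
rewrite dotC in cl; rewrite hk hl in ck cl *.
have k0 : k < 0 by rewrite -(ltrz0 R) -(pmulr_llt0 _ b0) ck; lra.
have l0 : l < 0 by rewrite -(ltrz0 R) -(pmulr_llt0 _ a0) cl; lra.
have kl4 : k * l < 4.
  rewrite -(ltr_int R) rmorphM /= -(ltr_pM2r (mulr_gt0 a0 b0)).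
  have -> : k%:~R * l%:~R * (dot a a * dot b b) =
    (k%:~R * dot b b) * (l%:~R * dot a a) :> R by ring.
  rewrite ck cl (_ : 2 * _ * _ = 4 * dot a b ^+ 2); last by ring.
  by rewrite ltr_pM2l.
have hkl : (k = -1 \/ l = -1) /\ (k = -1 \/ k = -2 \/ k = -3) by split; nia.
split; first by case: hkl.1 => ->; [left | right]; rewrite mulrN1z.
by case: hkl.2 => [|[|]] ->; [constructor 1 | constructor 2 | constructor 3].
Qed.

(** Depending on which Cartan integer is -1, the sum is the reflection of [a] in [b] or that of [b]
    in [a]. *)
Lemma root_add a b : a \in D -> b \in D -> dot a b < 0 -> a + b != 0 ->
  a + b \in D.
Proof.
move=> aD bD ab0 anb; have [[h|h] _] := cartan_lt0 aD bD ab0 anb.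
  by have := rs_reflection hD bD aD; rewrite /reflection h scaleN1r opprK.
by have := rs_reflection hD aD bD; rewrite /reflection h scaleN1r opprK addrC.
Qed.

Lemma root_sub a b : a \in D -> b \in D -> 0 < dot a b -> a != b ->
  a - b \in D.
Proof.
move=> aD bD ab0 anb; apply: root_add; rewrite ?root_oppE ?subr_eq0 //.
by rewrite dotNr oppr_lt0.
Qed.

(** For orthogonal roots the reflection in [b] exchanges [a + b] and [a - b]. *)
Lemma root_add_sub a b : a \in D -> b \in D -> dot a b = 0 -> a + b \in D ->
  a - b \in D.
Proof.
move=> aD bD ab0 /(rs_reflection hD bD); rewrite /reflection cartanD.
rewrite {1}/cartan ab0 mulr0 mul0r add0r /cartan mulfK ?gt_eqF ?root_norm_gt0 //.
by rewrite scaler_nat mulr2n opprD addrA addrK.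
Qed.

(** If the integer were -2 or -3, then [a + b + b] would be the reflection in [b] of [a] or of
    [a + b] respectively. *)
Lemma cartan_eqN1 a b : a \in D -> b \in D -> dot a b < 0 -> a + b != 0 ->
  a + b + b \notin D -> cartan a b = -1.
Proof.
move=> aD bD ab0 anb; have [_ [//|h|h]] := cartan_lt0 aD bD ab0 anb.
  have := rs_reflection hD bD aD.
  by rewrite /reflection h scaleNr opprK scaler_nat mulr2n addrA => ->.
have := rs_reflection hD bD (root_add aD bD ab0 anb).
rewrite /reflection cartanD h {1}/cartan mulfK ?gt_eqF ?root_norm_gt0 //.
have -> : -3 + 2 = -1 :> R by lra.
by rewrite scaleN1r opprK => ->.
Qed.

Hypothesis hirr : irreducible D.

(** The set and its complement in [D] would form an orthogonal decomposition, so irreducibility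
    empties the complement. This connectivity principle carries the global arguments below. *)
Lemma irreducible_ind (A : pred 'rV[R]_r) :
  (exists2 x, x \in D & A x) ->
  (forall x y, x \in D -> y \in D -> A x -> ~~ A y -> dot x y = 0) ->
  forall x, x \in D -> A x.
Proof.
case=> x0 x0D Ax0 orth x xD; apply: contraT => nAx.
pose X := [fset y in D | A y]; pose Y := [fset y in D | ~~ A y].
have XY : X `|` Y = D.
  by apply/fsetP => y; rewrite !inE -andb_orr orbN andbT.
have [X0|Y0] : X = fset0 \/ Y = fset0.
  apply: hirr.2 => // a b; rewrite !inE => /andP[aD Aa] /andP[bD Ab].
  exact: orth.
- by have : x0 \in X; [rewrite !inE x0D | rewrite X0 inE].
- by have : x \in Y; [rewrite !inE xD | rewrite Y0 inE].
Qed.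

End RootSystem.

(** * Colourings of the roots *)

Section Colouring.

Variables (R : rcfType) (r : nat) (D : {fset 'rV[R]_r}).
Hypotheses (hD : root_system D) (hirr : irreducible D).
Variables (T : eqType) (col : 'rV[R]_r -> T).
Hypothesis hcol : forall x y, x \in D -> y \in D -> x + y \in D ->
  col (x + y) = col x \/ col (x + y) = col y.
Implicit Types (x y z : 'rV[R]_r).

Lemma col_rule z x y : z = x + y -> x \in D -> y \in D -> z \in D ->
  col z = col x \/ col z = col y.
Proof. by move=> ->; apply: hcol. Qed.

Definition black x := col x != col (- x).

(** The pair of colours is compared up to exchange, so that [x] and [- x] have the same type. *)
Definition same_type x y :=
  (col x == col y) && (col (- x) == col (- y)) ||
  (col x == col (- y)) && (col (- x) == col y).

Lemma same_typeP x y : reflect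
  (col x = col y /\ col (- x) = col (- y) \/
   col x = col (- y) /\ col (- x) = col y) (same_type x y).
Proof.
apply: (iffP orP) => -[] h; [left|right|left|right];
  by [move/andP: h => [/eqP ? /eqP ?] | case: h => -> ->; rewrite !eqxx].
Qed.

Lemma same_type_refl x : same_type x x.
Proof. by rewrite /same_type !eqxx. Qed.

Lemma same_type_sym x y : same_type x y = same_type y x.
Proof. by apply/same_typeP/same_typeP; intuition congruence. Qed.

Lemma same_type_trans : transitive same_type.
Proof.
move=> y x z /same_typeP h1 /same_typeP h2; apply/same_typeP.
by intuition congruence.
Qed.

Lemma same_typeN x y : same_type x (- y) = same_type x y.
Proof. by rewrite /same_type opprK orbC. Qed.

Lemma blackN x : black (- x) = black x.
Proof. by rewrite /black opprK eq_sym. Qed.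

(* [hex x y] says that the colours of x, x + y, y, -x, -x - y, -y around a
   hexagon follow the pattern aabbcc with a, b, c distinct. *)
Definition hex x y :=
  [&& col (- x) == col y, col x != col (- x), col y != col (- y)
    & col x != col (- y)].

Lemma hexP x y : reflect
  [/\ col (- x) = col y, col x <> col (- x), col y <> col (- y)
    & col x <> col (- y)] (hex x y).
Proof.
apply: (iffP and4P) => -[/eqP h1 /eqP h2 /eqP h3 /eqP h4]; split=> //; exact/eqP.
Qed.

(** Since [x = (x + y) - y] and the colours of [x] and [- y] differ, the colour of [x] must come
    from [x + y]. The decomposition [- y = - (x + y) + x] settles the opposite root in the same
    way. *)
Lemma hex_sum x y : x \in D -> y \in D -> x + y \in D -> hex x y ->
  col (x + y) = col x /\ col (- (x + y)) = col (- y).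
Proof.
move=> xD yD xyD /hexP[h1 h2 h3 h4].
have nxD := root_opp hD xD; have nyD := root_opp hD yD.
have nxyD := root_opp hD xyD.
have := col_rule (erefl _) xD yD xyD.
have := col_rule (opprD x y) nxD nyD nxyD.
have e1 : x = (x + y) - y by rewrite addrK.
have e2 : - y = - (x + y) + x by rewrite opprD addrAC addNr add0r.
have := col_rule e1 xyD nyD xD.
have := col_rule e2 nxyD xD nyD.
by intuition congruence.
Qed.

(** If [x - y] were a root, [x = (x - y) + y] would give it the colour of [x], and
    [- y = (x - y) - x] the colour of [- y]; these differ. *)
Lemma hex_sub x y : x \in D -> y \in D -> hex x y -> x - y \notin D.
Proof.
move=> xD yD /hexP[h1 h2 h3 h4]; apply/negP => xyD.
have nxD := root_opp hD xD; have nyD := root_opp hD yD.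
have e1 : x = (x - y) + y by rewrite subrK.
have e2 : - y = (x - y) - x by rewrite addrAC subrr add0r.
have := col_rule e1 xyD yD xD.
have := col_rule e2 xyD nxD nyD.
by intuition congruence.
Qed.

Lemma hex_add_neq0 x y : hex x y -> x + y != 0.
Proof.
move/hexP => [h1 h2 h3 h4]; rewrite addr_eq0; apply/eqP => e.
by apply: h4; rewrite e.
Qed.

(** The pairs [x + y], [- y] and [- x], [x + y] are again hexagonal, so [hex_sub] excludes the roots
    x + 2y and 2x + y. Both Cartan integers are then -1, and the lengths agree. *)
Lemma hex_cartan x y : x \in D -> y \in D -> hex x y -> dot x y < 0 ->
  [/\ x + y \in D, cartan x y = -1 & dot x x = dot y y].
Proof.
move=> xD yD h xy0; have xy := hex_add_neq0 h.
have xyD := root_add hD xD yD xy0 xy.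
have [h1 h2] := hex_sum xD yD xyD h.
have nxD := root_opp hD xD; have nyD := root_opp hD yD.
have h3 : x + y + y \notin D.
  have := @hex_sub (x + y) (- y) xyD nyD; rewrite opprK; apply.
  by apply/hexP; rewrite opprK h1 h2; case/hexP: h => ? ? ? ?; split; congruence.
have h4 : y + x + x \notin D.
  have -> : y + x + x = - (- x - (x + y)).
    by rewrite -opprD opprK (addrC x y) [RHS]addrC.
  rewrite (root_oppE hD); apply: hex_sub nxD xyD _.
  by apply/hexP; rewrite opprK h1 h2; case/hexP: h => ? ? ? ?; split; congruence.
have c1 := cartan_eqN1 hD xD yD xy0 xy h3.
rewrite dotC in xy0; rewrite addrC in xy.
have c2 := cartan_eqN1 hD yD xD xy0 xy h4.
split => //; have := cartan_dot x (root_neq0 hD yD).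
by have := cartan_dot y (root_neq0 hD xD); rewrite c1 c2 (dotC y); lra.
Qed.

(** If [x + y] and its opposite took their colours from [x] and [- x], then [y] would have the type
    of [x]; likewise with [x] and [y] exchanged. In the mixed cases the remaining decompositions
    leave a hexagon or equal types. *)
Lemma link_hex x y : x \in D -> y \in D -> black x -> black y ->
  ~~ same_type x y -> dot x y < 0 -> hex x y \/ hex y x.
Proof.
move=> xD yD /eqP bx /eqP by_ st xy0.
have xy : x + y != 0.
  rewrite addr_eq0; apply: contra st => /eqP ->.
  by rewrite same_type_sym same_typeN same_type_refl.
have xyD := root_add hD xD yD xy0 xy.
have nxD := root_opp hD xD; have nyD := root_opp hD yD.
have nxyD := root_opp hD xyD.
have f1 := col_rule (erefl _) xD yD xyD.
have f2 := col_rule (opprD x y) nxD nyD nxyD.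
have e1 : x = (x + y) - y by rewrite addrK.
have e2 : - y = - (x + y) + x by rewrite opprD addrAC addNr add0r.
have e3 : y = (x + y) - x by rewrite addrAC subrr add0r.
have e4 : - x = - (x + y) + y by rewrite opprD addrNK.
have f3 := col_rule e1 xyD nyD xD.
have f4 := col_rule e2 nxyD xD nyD.
have f5 := col_rule e3 xyD nxD yD.
have f6 := col_rule e4 nxyD yD nxD.
have st' : ~ (col x = col y /\ col (- x) = col (- y) \/
   col x = col (- y) /\ col (- x) = col y).
  by move=> h; move/negP: st; apply; apply/same_typeP.
have [h|h] : col (- x) = col y \/ col (- y) = col x.
- by case: f1 => f1; case: f2 => f2; case: f3 => f3; case: f4 => f4;
    case: f5 => f5; case: f6 => f6; first [left; congruence | right; congruence
     | exfalso; congruence | exfalso; apply: st'; left; split; congruence].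
- by left; apply/hexP; split => // h'; apply: st'; right; split; congruence.
by right; apply/hexP; split => // h'; apply: st'; right; split; congruence.
Qed.

Lemma link_norm x y : x \in D -> y \in D -> black x -> black y ->
  ~~ same_type x y -> dot x y != 0 -> dot x x = dot y y.
Proof.
move=> xD yD bx by_ st; wlog xy0 : y yD by_ st / dot x y < 0 => [hw xy0|_].
  have [?|] := ltP (dot x y) 0; first exact: hw.
  rewrite le_eqVlt eq_sym (negPf xy0) /= => xy0'.
  have := hw (- y); rewrite root_oppE // blackN same_typeN !dotE opprK oppr_lt0.
  by rewrite oppr_eq0; exact.
have [h|h] := link_hex xD yD bx by_ st xy0; first by case: (hex_cartan xD yD h xy0).
by rewrite dotC in xy0; case: (hex_cartan yD xD h xy0).
Qed.

(** Call a root white if it is not black. Passing from [x] to [x + z] and back adds [z] or [- z],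
    which have one common colour, so a change of colour one way could not be undone the other way.
    Finally [z = (x + z) - x] restricts the colour of [z]. *)
Lemma white_add z x : z \in D -> x \in D -> ~~ black z -> black x ->
  x + z \in D ->
  [/\ col z = col x \/ col z = col (- x), col (x + z) = col x
    & col (- (x + z)) = col (- x)].
Proof.
move=> zD xD /negPn/eqP bz /eqP bx xzD.
have nxD := root_opp hD xD; have nzD := root_opp hD zD.
have nxzD := root_opp hD xzD.
have f1 := col_rule (erefl _) xD zD xzD.
have f2 := col_rule (opprD x z) nxD nzD nxzD.
have e1 : x = (x + z) - z by rewrite addrK.
have e2 : - z = - (x + z) + x by rewrite opprD addrAC addNr add0r.
have e3 : z = (x + z) - x by rewrite addrAC subrr add0r.
have e4 : - x = - (x + z) + z by rewrite opprD addrNK.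
have f3 := col_rule e1 xzD nzD xD.
have f4 := col_rule e2 nxzD xD nzD.
have f5 := col_rule e3 xzD nxD zD.
have f6 := col_rule e4 nxzD zD nxD.
by case: f1 => f1; case: f2 => f2; case: f3 => f3; case: f4 => f4;
  case: f5 => f5; case: f6 => f6; split;
  first [congruence | left; congruence | right; congruence].
Qed.

Lemma white_add_black z x : z \in D -> x \in D -> ~~ black z -> black x ->
  x + z \in D -> black (x + z) /\ same_type x (x + z).
Proof.
move=> zD xD bz bx xzD; have [h1 h2 h3] := white_add zD xD bz bx xzD.
by rewrite /black /same_type h2 h3 !eqxx.
Qed.

(** Connectivity for black roots: let [A] consist of [X] and the white roots not orthogonal to [X].
    It is orthogonal to its complement in [D], hence is all of [D]; a change of sign then yields an
    obtuse angle. *)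
Lemma black_ind (X : pred 'rV[R]_r) :
  (exists2 x, x \in D & X x) ->
  (forall x, x \in D -> X x -> black x) ->
  (forall x y, x \in D -> y \in D -> X x -> black y -> dot x y != 0 -> X y) ->
  (forall x z, x \in D -> z \in D -> X x -> ~~ black z -> x + z \in D ->
     X (x + z)) ->
  (forall x, x \in D -> black x -> X x) /\
  (forall z, z \in D -> exists x, [/\ x \in D, X x & dot x z < 0]).
Proof.
move=> [x0 x0D Xx0] Xb Xbl Xw.
pose A z := X z || ~~ black z && has (fun x => X x && (dot x z != 0)) D.
have claim u v : u \in D -> v \in D -> X u -> ~~ A v -> dot u v = 0.
  move=> uD vD Xu; rewrite negb_or => /andP[nXv]; apply: contraNeq => uv.
  have [bv|/= bv] := boolP (black v); first by rewrite (Xbl u v) in nXv.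
  by apply/hasP; exists u => //; rewrite Xu.
have all_A z : z \in D -> A z.
  apply: (irreducible_ind hirr); first by exists x0; rewrite // /A Xx0.
  move=> u v uD vD; case/orP => [Xu|/andP[bu /hasP[x xD /andP[Xx xu]]]] nAv.
    exact: claim.
  have xv := claim x v xD vD Xx nAv.
  (* The root [v], being outside [A], is orthogonal to [x] and to [x + w], both in [X], hence to
     [w]. This is applied to [u] or to [- u]. *)
  have Xux w : x + w \in D -> w \in D -> ~~ black w -> dot w v = 0.
    move=> xwD wD bw; have := claim (x + w) v xwD vD (Xw _ _ xD wD Xx bw xwD) nAv.
    by rewrite dotDl xv add0r.
  have [xu0|xu0] := ltP (dot x u) 0.
    apply: Xux => //; apply: root_add => //.
    by rewrite addr_eq0; apply: contraTneq (Xb x xD Xx) => ->; rewrite blackN.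
  apply/eqP; rewrite -oppr_eq0 -dotNl; apply/eqP.
  apply: Xux; rewrite ?blackN ?root_oppE //.
  apply: root_sub => //; first by rewrite lt_def xu.
  by apply: contraTneq (Xb x xD Xx) => ->.
have XN x : x \in D -> X x -> X (- x).
  move=> xD Xx; apply: (Xbl x) => //; rewrite ?root_oppE ?blackN ?Xb //.
  by rewrite dotNr oppr_eq0 gt_eqF ?(root_norm_gt0 hD).
split=> [x xD bx|z zD].
  by have := all_A x xD; rewrite /A bx /= orbF.
have : exists x, [/\ x \in D, X x & dot x z != 0].
  have /orP[Xz|/andP[_ /hasP[x xD /andP[]]]] := all_A z zD; last by exists x.
  by exists z; split; rewrite ?gt_eqF ?(root_norm_gt0 hD).
case=> x [xD Xx xz]; have [xz0|xz0] := ltP (dot x z) 0; first by exists x.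
exists (- x); split; rewrite ?root_oppE ?XN // dotNl oppr_lt0.
by rewrite lt_def xz.
Qed.

(** Without a hexagon, non-orthogonal black roots have the same type. If there is a black root, that
    type spreads to all black roots and every white root takes one of its two colours, so only two
    colours occur. If all roots are white, the colour is constant along non-orthogonal roots, so
    only one occurs. *)
Lemma hex_exists z1 z2 z3 : z1 \in D -> z2 \in D -> z3 \in D ->
  col z1 != col z2 -> col z1 != col z3 -> col z2 != col z3 ->
  exists x y, [/\ x \in D, y \in D, hex x y & dot x y < 0].
Proof.
move=> z1D z2D z3D n12 n13 n23.
have [/hasP[x xD /hasP[y yD /andP[h xy]]]|nhex] :=
  boolP (has (fun x => has (fun y => hex x y && (dot x y < 0)) D) D).
  by exists x, y.
have {}nhex x y : x \in D -> y \in D -> dot x y < 0 -> ~~ hex x y.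
  move=> xD yD xy0; apply: contra nhex => h; apply/hasP; exists x => //.
  by apply/hasP; exists y; rewrite // h.
have nlink x y : x \in D -> y \in D -> black x -> black y -> dot x y != 0 ->
    same_type x y.
  move=> xD yD bx by_; wlog xy0 : y yD by_ / dot x y < 0 => [hw xy0|_].
    have [?|] := ltP (dot x y) 0; first exact: hw.
    rewrite le_eqVlt eq_sym (negPf xy0) /= => xy0'.
    have := hw (- y); rewrite root_oppE // blackN same_typeN !dotE.
    by rewrite oppr_lt0 oppr_eq0; exact.
  apply: contraT => st; have [h|h] := link_hex xD yD bx by_ st xy0.
    by move: (nhex _ _ xD yD xy0); rewrite h.
  by rewrite dotC in xy0; move: (nhex _ _ yD xD xy0); rewrite h.
exfalso; have [/hasP[x0 x0D bx0]|nblack] := boolP (has black D).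
  pose X x := black x && same_type x0 x.
  have [|||| _ hX] := @black_ind X.
  - by exists x0; rewrite // /X bx0 same_type_refl.
  - by move=> x _ /andP[].
  - move=> x y xD yD /andP[bx st] by_ xy; rewrite /X by_.
    by apply: same_type_trans st _; apply: nlink.
  - move=> x z xD zD /andP[bx st] bz xzD; rewrite /X.
    have [-> st'] := white_add_black zD xD bz bx xzD.
    exact: same_type_trans st'.
  have two z : z \in D -> col z = col x0 \/ col z = col (- x0).
    move=> zD; have [x [xD /andP[bx /same_typeP st] xz]] := hX z zD.
    have [bz|bz] := boolP (black z).
      have /same_typeP := nlink x z xD zD bx bz (ltr0_neq0 xz).
      by intuition congruence.
    have xzD : x + z \in D.
      apply: root_add => //; rewrite addr_eq0; apply: contraNneq bz => e.
      by rewrite -blackN -e.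
    by have [] := white_add zD xD bz bx xzD; intuition congruence.
  have := two _ z1D; have := two _ z2D; have := two _ z3D.
  by move: n12 n13 n23 => /eqP ? /eqP ? /eqP ?; intuition congruence.
have {}nblack x : x \in D -> col (- x) = col x.
  by move=> xD; apply/eqP; rewrite eq_sym; apply: contraNT nblack => b; apply/hasP; exists x.
have : col z2 == col z1; last by rewrite eq_sym (negPf n12).
apply: (@irreducible_ind _ _ _ hirr (fun z => col z == col z1)) => //.
  by exists z1.
move=> x y xD yD /eqP ex ny; apply/eqP; apply: contraNT ny => xy.
wlog xy0 : y yD xy / dot x y < 0 => [hw|].
  have [?|] := ltP (dot x y) 0; first exact: hw.
  rewrite le_eqVlt eq_sym (negPf xy) /= => xy0.
  have := hw (- y); rewrite root_oppE // nblack // dotNr oppr_lt0 oppr_eq0.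
  exact.
have [e|xyn] := eqVneq (x + y) 0.
  by move/eqP: e; rewrite addr_eq0 => /eqP e; rewrite -ex e nblack.
have xyD := root_add hD xD yD xy0 xyn.
have nxD := root_opp hD xD; have nyD := root_opp hD yD.
have e1 : x = (x + y) - y by rewrite addrK.
have e3 : y = (x + y) - x by rewrite addrAC subrr add0r.
have := col_rule e1 xyD nyD xD; have := col_rule e3 xyD nxD yD.
have := col_rule (erefl _) xD yD xyD; rewrite !nblack // => f1 f2 f3.
by apply/eqP; intuition congruence.
Qed.

(** * Equality of the root lengths *)

Definition linked x := has (fun y => [&& black y, ~~ same_type x y & dot x y != 0]) D.

(** Besides [y], the third direction [x + y] of the hexagon is provided: a root not orthogonal to
    [x] cannot be orthogonal to both. *)
Lemma linkedP x : black x -> linked x -> x \in D ->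
  exists y, [/\ y \in D, black y, ~~ same_type x y, dot x y < 0
    & [/\ x + y \in D, black (x + y), ~~ same_type x (x + y),
      dot x x = dot y y & dot (x + y) (x + y) = dot x x]].
Proof.
move=> bx /hasP[y yD /and3P[by_ st xy]] xD.
wlog xy0 : y yD by_ st xy / dot x y < 0 => [hw|].
  have [?|] := ltP (dot x y) 0; first exact: (hw y).
  rewrite le_eqVlt eq_sym (negPf xy) /= => xy0.
  by have := hw (- y); rewrite root_oppE // blackN same_typeN !dotE oppr_lt0 oppr_eq0; exact.
exists y; split => //.
have [h|h] := link_hex xD yD bx by_ st xy0.
  have [xyD c n] := hex_cartan xD yD h xy0.
  have [h1 h2] := hex_sum xD yD xyD h.
  have /hexP[a1 a2 a3 a4] := h.
  split => //; first by rewrite /black h1 h2; apply/eqP.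
    by apply/negP => /same_typeP; rewrite h1 h2; intuition congruence.
  have := cartan_dot x (root_neq0 hD yD); rewrite c !dotE (dotC y x) -n; lra.
have yx0 := xy0; rewrite dotC in yx0.
have [yxD c n] := hex_cartan yD xD h yx0.
have [h1 h2] := hex_sum yD xD yxD h.
have /hexP[a1 a2 a3 a4] := h.
rewrite (addrC x y); split => //; first by rewrite /black h1 h2; apply/eqP.
  by apply/negP => /same_typeP; rewrite h1 h2; intuition congruence.
have := cartan_dot y (root_neq0 hD xD); rewrite c !dotE (dotC y x) n; lra.
Qed.

(** Being linked with squared length [n0] spreads through [black_ind]. A black neighbour of [x] of
    another type is handled by [link_norm]; one of the same type is not orthogonal to one of the two
    partners of [x] in its hexagon, which have another type and the right length. *)
Lemma norm_black_const n0 :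
  (exists x, [/\ x \in D, black x, linked x & dot x x = n0]) ->
  (forall x, x \in D -> black x -> dot x x = n0) /\
  (forall z, z \in D -> exists x, [/\ x \in D, black x, dot x x = n0 & dot x z < 0]).
Proof.
move=> [x0 [x0D bx0 lx0 nx0]].
pose X x := [&& black x, linked x & dot x x == n0].
have Xlink x y : x \in D -> y \in D -> black x -> black y -> dot x x = n0 ->
    ~~ same_type y x -> dot y x != 0 -> X y.
  move=> xD yD bx by_ nx st xy; apply/and3P; split => //.
    by apply/hasP; exists x => //; apply/and3P.
  by rewrite (link_norm yD xD by_ bx st xy) nx.
have [||||hb hw] := @black_ind X.
- by exists x0 => //; apply/and3P; rewrite nx0.
- by move=> x _ /and3P[].
- move=> x y xD yD /and3P[bx lx /eqP nx] by_ xy.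
  have [st|st] := boolP (same_type y x); last by apply: (Xlink x); rewrite 1?dotC.
  have [z [zD bz stz xz [xzD bxz stxz nz nxz]]] := linkedP bx lx xD.
  have [yz|yz] := eqVneq (dot y z) 0; last first.
    apply: (Xlink z) => //; first by rewrite -nz.
    by apply: contra stz; apply: same_type_trans; rewrite same_type_sym.
  apply: (Xlink (x + z)) => //; first by rewrite nxz.
    by apply: contra stxz; apply: same_type_trans; rewrite same_type_sym.
  by rewrite dotDr yz addr0 dotC.
- move=> x z xD zD /and3P[bx lx /eqP nx] bz xzD.
  have [bxz st] := white_add_black zD xD bz bx xzD.
  have [y [yD by_ sty xy [xyD bxy stxy ny nxy]]] := linkedP bx lx xD.
  have sty' : ~~ same_type (x + z) y.
    by apply: contra sty; apply: same_type_trans.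
  have [e1|e1] := eqVneq (dot (x + z) y) 0; last by apply: (Xlink y) => //; rewrite -ny.
  have [e2|e2] := eqVneq (dot (x + z) (x + y)) 0; last first.
    apply: (Xlink (x + y)) => //; first by rewrite nxy.
    by apply: contra stxy; apply: same_type_trans.
  (* x and x + z are orthogonal with difference z, hence x + (x + z) is also a
     root; it is linked to y, hence as long as x, which is absurd *)
  exfalso; have e3 : dot (x + z) x = 0 by move: e2; rewrite [X in X = _]dotDr e1 addr0.
  have nxD := root_opp hD xD.
  have uD : x + z + x \in D.
    rewrite -{2}(opprK x); apply: root_add_sub => //.
      by rewrite dotNr e3 oppr0.
    by rewrite addrAC subrr add0r.
  have stx : same_type x (x + z + x).
    have [f1 f2 f3] := white_add zD xD bz bx xzD.
    have g1 := col_rule (erefl _) xzD xD uD.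
    have nxzD := root_opp hD xzD; have nuD := root_opp hD uD.
    have g2 := col_rule (opprD (x + z) x) nxzD nxD nuD.
    by apply/same_typeP; left; case: g1 => ->; case: g2 => ->; rewrite ?f2 ?f3.
  have bu : black (x + z + x).
    by case/same_typeP: stx => -[h1 h2]; rewrite /black -h1 -h2 // eq_sym.
  have uy : dot (x + z + x) y != 0 by rewrite dotDl e1 add0r ltr0_neq0.
  have stu : ~~ same_type (x + z + x) y.
    by apply: contra sty; apply: same_type_trans.
  have := link_norm uD yD bu by_ stu uy; rewrite -ny dotDl !(dotDr (x + z) x).
  rewrite (dotC x (x + z)) e3; have := root_norm_gt0 hD xzD; lra.
split=> [x xD bx|z zD]; first by have /and3P[_ _ /eqP] := hb x xD bx.
by have [x [xD /and3P[bx _ /eqP]]] := hw z zD; exists x.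
Qed.

(** Black roots are settled by [norm_black_const]. A white [z] has an obtuse angle with a black [x].
    If the Cartan integer is -1, the known lengths of [x] and [x + z] give that of [z]; otherwise
    the reflection of [z] in [x] is black and as long as [z]. *)
Lemma norm_const x0 y0 : x0 \in D -> y0 \in D -> hex x0 y0 -> dot x0 y0 < 0 ->
  forall z, z \in D -> dot z z = dot x0 x0.
Proof.
move=> x0D y0D h xy0; set n0 := dot x0 x0.
have n0gt : 0 < n0 by apply: (root_norm_gt0 hD).
have [|hb hw] := @norm_black_const n0.
  have /hexP[a1 a2 a3 a4] := h; exists x0; split=> //; first exact/eqP.
  apply/hasP; exists y0 => //; apply/and3P; split; [exact/eqP| |exact: ltr0_neq0].
  by apply/negP => /same_typeP; intuition congruence.
move=> z zD; have [x [xD bx nx xz]] := hw z zD.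
have [bz|bz] := boolP (black z); first exact: hb.
have xzn : x + z != 0.
  by rewrite addr_eq0; apply: contra bz => /eqP e; rewrite -blackN -e.
have xzD := root_add hD xD zD xz xzn.
have [bxz _] := white_add_black zD xD bz bx xzD.
have /eqP bx' := bx; have [_ f2 f3] := white_add zD xD bz bx xzD.
(* Along the string through [z] in direction [x], the two colours of [x] persist from [x + z] on. *)
have step u : u \in D -> col u = col x -> col (- u) = col (- x) -> u + x \in D ->
    [/\ col (u + x) = col x, col (- (u + x)) = col (- x) & black (u + x)].
  move=> uD h1 h2 uxD; have nuD := root_opp hD uD.
  have nxD := root_opp hD xD; have nuxD := root_opp hD uxD.
  have g1 := col_rule (erefl _) uD xD uxD.
  have g2 := col_rule (opprD u x) nuD nxD nuxD.
  have [g3 g4] : col (u + x) = col x /\ col (- (u + x)) = col (- x).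
    by case: g1 => ->; case: g2 => ->.
  by rewrite /black g3 g4.
have e1 : dot z z + 2 * dot x z = 0.
  by have := hb _ xzD bxz; rewrite !dotE (dotC z x) nx; lra.
have zx : dot z x < 0 by rewrite dotC.
have zxn : z + x != 0 by rewrite addrC.
have zxD : z + x \in D by rewrite addrC.
have x0' := root_neq0 hD xD.
have cz := cartan_dot z x0'; rewrite nx (dotC z x) in cz.
have [c1|c1|c1] := (cartan_lt0 hD zD xD zx zxn).2; rewrite c1 in cz.
- lra.
- have nz := reflection_norm z x0'; have rD := rs_reflection hD xD zD.
  move: nz rD; rewrite /reflection c1 scaleNr opprK scaler_nat mulr2n addrA.
  move=> nz rD; have [||_ _ b] := step _ zxD _ _ rD; rewrite ?(addrC z x) //.
  by rewrite -(hb _ rD b) nz.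
(* The integer is -3: the reflection z + 3x of [z] is reached through the root z + 2x, the
   reflection of [z + x], so [step] is used twice. *)
- have nz := reflection_norm z x0'; have rD := rs_reflection hD xD zD.
  have rD' := rs_reflection hD xD zxD.
  have cx : cartan x x = 2 by rewrite /cartan mulfK // gt_eqF // nx.
  move: nz rD rD'; rewrite /reflection cartanD c1 cx.
  have -> : -3 + 2 = - 1 :> R by lra.
  rewrite !scaleNr !opprK scale1r scaler_nat !mulrS mulr0n addr0 !addrA => nz rD rD'.
  have [||g1 g2 _] := step _ zxD _ _ rD'; rewrite ?(addrC z x) //.
  have [_ _ b] := step _ rD' g1 g2 rD.
  by rewrite -(hb _ rD b) nz.
Qed.

End Colouring.

(** * Coloured families with all differences roots *)

Ltac vring := by apply/rowP => ?; rewrite !mxE; ring.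

(** Products of differences depend only on mutual squared distances, which are known in a family
    whose differences are roots of one length. *)
Lemma dot_polar (R : rcfType) (r : nat) (a b c d : 'rV[R]_r) :
  2 * dot (a - b) (c - d) = dot (a - d) (a - d) + dot (b - c) (b - c)
    - dot (a - c) (a - c) - dot (b - d) (b - d).
Proof.
rewrite !dotE (dotC d a) (dotC c b) (dotC c a) (dotC d b); ring.
Qed.

(** The [c]'s are the colours of three family members; [z] and [y] with the same index are the
    colours of the difference from that member to a new vector and of its opposite. If [z1] were not
    [c1], then [z1 = z2 = z3] and [y2 = y3 = c1], whence [c2 = z2 = z3 = c3]. *)
Lemma three_colours_first (T : eqType) (z1 z2 z3 y2 y3 c1 c2 c3 : T) :
  c1 <> c2 -> c1 <> c3 -> c2 <> c3 ->
  z1 = z2 \/ z1 = c1 -> z1 = z3 \/ z1 = c1 ->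
  c1 = z1 \/ c1 = y2 -> c1 = z1 \/ c1 = y3 ->
  c2 = z2 \/ c2 = y3 -> c3 = z3 \/ c3 = y2 -> z1 = c1.
Proof.
move=> n12 n13 n23 h1 h2 h3 h4 h5 h6.
have [//|/eqP n] := eqVneq z1 c1.
by case: h1 => h1; case: h2 => h2; case: h3 => h3; case: h4 => h4;
  case: h5 => h5; case: h6 => h6; congruence.
Qed.

Section Frames.

Variables (R : rcfType) (r : nat) (D : {fset 'rV[R]_r}).
Hypotheses (hD : root_system D) (hirr : irreducible D).
Variables (T : eqType) (col : 'rV[R]_r -> T).
Hypothesis hcol : forall x y, x \in D -> y \in D -> x + y \in D ->
  col (x + y) = col x \/ col (x + y) = col y.
Variable q : R.
Hypothesis hq : forall z, z \in D -> dot z z = 2 * q.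
Implicit Types (x y z : 'rV[R]_r) (p : 'rV[R]_r * T) (s : seq ('rV[R]_r * T)).

Lemma simply_laced x y : x \in D -> y \in D -> x != y -> x != - y ->
  [\/ dot x y = - q, dot x y = 0 | dot x y = q].
Proof.
have neg u v : u \in D -> v \in D -> u != - v -> dot u v < 0 -> dot u v = - q.
  move=> uD vD nuv uv; rewrite -addr_eq0 in nuv.
  have [h _] := cartan_lt0 hD uD vD uv nuv.
  have := cartan_dot u (root_neq0 hD vD); have := cartan_dot v (root_neq0 hD uD).
  rewrite (dotC v) !hq //; case: h => ->; lra.
move=> xD yD nxy nxNy; have [xy|xy|xy] := ltrgtP (dot x y) 0.
- by constructor 1; exact: neg.
- constructor 3; have := neg x (- y); rewrite root_oppE // opprK dotNr oppr_lt0.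
  by move=> h; have := h xD yD nxy xy; lra.
- by constructor 2.
Qed.

Definition frame s := forall p p', p \in s -> p' \in s -> p != p' ->
  p.1 - p'.1 \in D /\ col (p.1 - p'.1) = p.2.

Definition three_coloured s := exists p1 p2 p3,
  [/\ p1 \in s, p2 \in s, p3 \in s & [/\ p1.2 <> p2.2, p1.2 <> p3.2 & p2.2 <> p3.2]].

Lemma q_gt0 z : z \in D -> 0 < q.
Proof. by move=> zD; have := root_norm_gt0 hD zD; rewrite hq //; lra. Qed.

(** The differences between [e] and the family are roots; only their colours are in question. The
    three colours present force the differences towards [e] to keep the colour of their first
    member, and those starting at [e] to have one common colour. *)
Lemma frame_extend s p0 z : frame s -> three_coloured s -> p0 \in s -> z \in D ->
  (forall p, p \in s -> p != p0 -> z - (p0.1 - p.1) \in D) ->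
  exists c, frame ((p0.1 - z, c) :: s).
Proof.
move=> fs [p1 [p2 [p3 [s1 s2 s3 [n12 n13 n23]]]]] p0s zD hz.
set e := p0.1 - z.
have eD p : p \in s -> p.1 - e \in D.
  move=> ps; rewrite /e opprD opprK addrA; have [->|np] := eqVneq p p0.
    by rewrite subrr add0r.
  by have := hz p ps np; rewrite opprB addrC.
have neD p : p \in s -> e - p.1 \in D by move=> ps; rewrite -opprB root_oppE ?eD.
have r1 p p' : p \in s -> p' \in s -> p != p' ->
    col (p.1 - e) = col (p'.1 - e) \/ col (p.1 - e) = p.2.
  move=> ps ps' n; have [nD <-] := fs p p' ps ps' n.
  have e1 : p.1 - e = (p'.1 - e) + (p.1 - p'.1) by rewrite [RHS]addrC addrA subrK.
  by apply: (col_rule hcol e1); rewrite ?eD.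
have r2 p p' : p \in s -> p' \in s -> p != p' ->
    col (e - p.1) = col (e - p'.1) \/ col (e - p.1) = p'.2.
  move=> ps ps' n; rewrite eq_sym in n; have [nD <-] := fs p' p ps' ps n.
  have e1 : e - p.1 = (e - p'.1) + (p'.1 - p.1) by rewrite addrA subrK.
  by apply: (col_rule hcol e1); rewrite ?neD.
have r3 p p' : p \in s -> p' \in s -> p != p' ->
    p.2 = col (p.1 - e) \/ p.2 = col (e - p'.1).
  move=> ps ps' n; have [nD <-] := fs p p' ps ps' n.
  have e1 : p.1 - p'.1 = (p.1 - e) + (e - p'.1) by rewrite addrA subrK.
  by apply: (col_rule hcol e1); rewrite ?neD ?eD.
have ne p p' : p.2 <> p'.2 -> p != p' by apply: contra_notN => /eqP ->.
have n21 := nesym n12; have n31 := nesym n13; have n32 := nesym n23.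
have z1 : col (p1.1 - e) = p1.2.
  by apply: (three_colours_first n12 n13 n23 (r1 p1 p2 _ _ _) (r1 p1 p3 _ _ _)
    (r3 p1 p2 _ _ _) (r3 p1 p3 _ _ _) (r3 p2 p3 _ _ _) (r3 p3 p2 _ _ _)) => //; exact: ne.
have z2 : col (p2.1 - e) = p2.2.
  by apply: (three_colours_first n21 n23 n13 (r1 p2 p1 _ _ _) (r1 p2 p3 _ _ _)
    (r3 p2 p1 _ _ _) (r3 p2 p3 _ _ _) (r3 p1 p3 _ _ _) (r3 p3 p1 _ _ _)) => //; exact: ne.
have z3 : col (p3.1 - e) = p3.2.
  by apply: (three_colours_first n31 n32 n12 (r1 p3 p1 _ _ _) (r1 p3 p2 _ _ _)
    (r3 p3 p1 _ _ _) (r3 p3 p2 _ _ _) (r3 p1 p2 _ _ _) (r3 p2 p1 _ _ _)) => //; exact: ne.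
(* If this colour were not [p.2], it would equal both [p1.2] and [p2.2], which differ. *)
have zE p : p \in s -> col (p.1 - e) = p.2.
  move=> ps; have [->//|m1] := eqVneq p p1; have [->//|m2] := eqVneq p p2.
  have := r1 p p1 ps s1 m1; have := r1 p p2 ps s2 m2; rewrite z1 z2.
  by case=> h1 [] h2; congruence.
(* If the two colours differed, they would be [p2.2] and [p1.2], and comparison with [p3] would make
   both equal to the colour of [e - p3.1]. *)
have y12 : col (e - p1.1) = col (e - p2.1).
  have := r2 p1 p2 s1 s2 (ne _ _ n12); have := r2 p2 p1 s2 s1 (ne _ _ n21).
  have := r2 p1 p3 s1 s3 (ne _ _ n13); have := r2 p3 p1 s3 s1 (ne _ _ n31).
  have := r2 p2 p3 s2 s3 (ne _ _ n23); have := r2 p3 p2 s3 s2 (ne _ _ n32).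
  by do 6 case=> ?; congruence.
have y13 : col (e - p1.1) = col (e - p3.1).
  have := r2 p1 p2 s1 s2 (ne _ _ n12); have := r2 p2 p1 s2 s1 (ne _ _ n21).
  have := r2 p1 p3 s1 s3 (ne _ _ n13); have := r2 p3 p1 s3 s1 (ne _ _ n31).
  have := r2 p2 p3 s2 s3 (ne _ _ n23); have := r2 p3 p2 s3 s2 (ne _ _ n32).
  by do 6 case=> ?; congruence.
have yE p : p \in s -> col (e - p.1) = col (e - p1.1).
  move=> ps; have [->//|m1] := eqVneq p p1; have [->//|m2] := eqVneq p p2.
  have := r2 p p1 ps s1 m1; have := r2 p p2 ps s2 m2.
  by case=> h1 [] h2; congruence.
exists (col (e - p1.1)) => p p'; rewrite !inE.
case/predU1P => [->|ps] /predU1P [->|ps'] n; rewrite ?eqxx // in n *.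
- by rewrite neD ?yE.
- by rewrite eD ?zE.
- exact: fs.
Qed.

(* Write d a b for the root obtained from z = d p1 p2 by moving the pair of
   indices on which it is high to {a, b}. Then p_b - p_c = d a b - d a c, so the
   colour of p_b is that of d a b or of - d a c; choosing among these options for
   the pairs inside {p1, p2, p3} forces the colours of the roots - d p_a p4,
   which then contradict the colouring rule. *)
Lemma no_split_colours s p1 p2 p3 p4 z : frame s ->
  p1 \in s -> p2 \in s -> p3 \in s -> p4 \in s ->
  p1 != p4 -> p2 != p4 -> p3 != p4 ->
  p1.2 <> p2.2 -> p1.2 <> p3.2 -> p2.2 <> p3.2 ->
  z \in D -> z - (p2.1 - p3.1) \in D -> z - (p2.1 - p4.1) \in D ->
  z - (p1.1 - p3.1) \in D -> z - (p1.1 - p4.1) \in D ->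
  z - (p1.1 - p3.1) - (p2.1 - p4.1) \in D -> False.
Proof.
move=> fs s1 s2 s3 s4 n14 n24 n34 m12 m13 m23.
pose d (a b : 'rV[R]_r) := z - (p1.1 + p2.1) + (a + b).
have dC a b : d a b = d b a by rewrite /d (addrC a).
have -> : z = d p1.1 p2.1 by rewrite /d subrK.
have e1 a : d p1.1 p2.1 - (p2.1 - a) = d p1.1 a by rewrite /d; vring.
have e2 a : d p1.1 p2.1 - (p1.1 - a) = d p2.1 a by rewrite /d; vring.
have e3 a b : d p1.1 p2.1 - (p1.1 - a) - (p2.1 - b) = d a b by rewrite /d; vring.
rewrite e3 !e1 !e2 => d12 d13 d14 d23 d24 d34.
have ne p p' : p.2 <> p'.2 -> p != p' by apply: contra_notN => /eqP ->.
have r1 (x : 'rV[R]_r) p p' : p \in s -> p' \in s -> p != p' ->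
    d x p.1 \in D -> d x p'.1 \in D ->
    p.2 = col (d x p.1) \/ p.2 = col (- d x p'.1).
  move=> ps ps' n dx dx'; have [nD <-] := fs p p' ps ps' n.
  apply: (col_rule hcol _) nD; rewrite ?root_oppE // /d; vring.
have r2 (x : 'rV[R]_r) p p' : p \in s -> p' \in s -> p != p' ->
    d x p.1 \in D -> d x p'.1 \in D ->
    col (- d x p.1) = col (- d x p'.1) \/ col (- d x p.1) = p'.2.
  move=> ps ps' n dx dx'; rewrite eq_sym in n; have [nD <-] := fs p' p ps' ps n.
  apply: (col_rule hcol _) ; rewrite ?root_oppE // /d; vring.
have ne12 := ne _ _ m12; have ne13 := ne _ _ m13; have ne23 := ne _ _ m23.
have ne21 : p2 != p1 by rewrite eq_sym.
have ne31 : p3 != p1 by rewrite eq_sym.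
have ne32 : p3 != p2 by rewrite eq_sym.
have d21 := d12; have d31 := d13; have d32 := d23.
have d41 := d14; have d42 := d24; have d43 := d34.
rewrite dC in d21; rewrite dC in d31; rewrite dC in d32.
rewrite dC in d41; rewrite dC in d42; rewrite dC in d43.
have a1 := r1 p1.1 p2 p3 s2 s3 ne23 d12 d13.
have a2 := r1 p1.1 p2 p4 s2 s4 n24 d12 d14.
have a3 := r1 p2.1 p1 p3 s1 s3 ne13 d21 d23.
have a4 := r1 p2.1 p1 p4 s1 s4 n14 d21 d24.
have a5 := r1 p1.1 p3 p2 s3 s2 ne32 d13 d12.
have a6 := r1 p1.1 p3 p4 s3 s4 n34 d13 d14.
have a7 := r1 p3.1 p1 p2 s1 s2 ne12 d31 d32.
have a8 := r1 p3.1 p1 p4 s1 s4 n14 d31 d34.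
have a9 := r1 p2.1 p3 p1 s3 s1 ne31 d23 d21.
have a10 := r1 p2.1 p3 p4 s3 s4 n34 d23 d24.
have a11 := r1 p3.1 p2 p1 s2 s1 ne21 d32 d31.
have a12 := r1 p3.1 p2 p4 s2 s4 n24 d32 d34.
have b1 := r2 p4.1 p2 p1 s2 s1 ne21 d42 d41.
have b2 := r2 p4.1 p1 p2 s1 s2 ne12 d41 d42.
rewrite !(dC p2.1 p1.1) !(dC p3.1 p1.1) !(dC p3.1 p2.1) !(dC p4.1 _) in a1 a2 a3 a4 a5 a6 a7 a8 a9 a10 a11 a12 b1 b2.
(* For each pair inside {p1, p2, p3}, the root [d] of the pair misses the colour of at least one of
   its two members. Unless the three missed members are distinct, some [- d p_a p4] receives two
   colours; if they are distinct, the three roots [- d p_a p4] receive three different colours,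
   against [b1] or [b2]. *)
have c1 : p1.2 <> col (d p1.1 p2.1) \/ p2.2 <> col (d p1.1 p2.1).
  by case: (eqVneq p1.2 (col (d p1.1 p2.1))) => [|/eqP]; [right; congruence | left].
have c2 : p1.2 <> col (d p1.1 p3.1) \/ p3.2 <> col (d p1.1 p3.1).
  by case: (eqVneq p1.2 (col (d p1.1 p3.1))) => [|/eqP]; [right; congruence | left].
have c3 : p2.2 <> col (d p2.1 p3.1) \/ p3.2 <> col (d p2.1 p3.1).
  by case: (eqVneq p2.2 (col (d p2.1 p3.1))) => [|/eqP]; [right; congruence | left].
case: c1 => c1.
  have {}a3 : p1.2 = col (- d p2.1 p3.1) by case: a3.
  have {}a4 : p1.2 = col (- d p2.1 p4.1) by case: a4.
  case: c3 => c3; last first.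
    by case: a10 => a10; congruence.
  have {}a12 : p2.2 = col (- d p3.1 p4.1) by case: a12.
  case: c2 => c2; first by case: a8 => a8; congruence.
  have {}a6 : p3.2 = col (- d p1.1 p4.1) by case: a6.
  by case: b2 => b2; congruence.
have {}a2 : p2.2 = col (- d p1.1 p4.1) by case: a2.
case: c2 => c2; last by case: a6 => a6; congruence.
have {}a8 : p1.2 = col (- d p3.1 p4.1) by case: a8.
case: c3 => c3; first by case: a12 => a12; congruence.
have {}a10 : p3.2 = col (- d p2.1 p4.1) by case: a10.
by case: b1 => b1; congruence.
Qed.

Lemma frame_dot0 s a b a' b' : frame s ->
  a \in s -> b \in s -> a' \in s -> b' \in s ->
  a != a' -> a != b' -> b != a' -> b != b' ->
  dot (a.1 - b.1) (a'.1 - b'.1) = 0.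
Proof.
move=> fs sa sb sa' sb' n1 n2 n3 n4; have := dot_polar a.1 b.1 a'.1 b'.1.
by rewrite !hq ?(fs _ _ _ _ _).1 //; lra.
Qed.

Lemma frame_dotq s a b c : frame s -> a \in s -> b \in s -> c \in s ->
  a != b -> a != c -> b != c -> dot (a.1 - b.1) (a.1 - c.1) = q.
Proof.
move=> fs sa sb sc n1 n2 n3; have := dot_polar a.1 b.1 a.1 c.1.
rewrite subrr dot0l !hq ?(fs _ _ _ _ _).1 //; [lra | by rewrite eq_sym].
Qed.

Lemma frame_sub s z a b : frame s -> a \in s -> b \in s -> z \in D ->
  a != b -> dot z (a.1 - b.1) = q -> z - (a.1 - b.1) \in D.
Proof.
move=> fs sa sb zD nab e; have nD := (fs a b sa sb nab).1.
have q0 := q_gt0 zD; apply: root_sub => //; first by rewrite e.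
by apply: contra_eqN e => /eqP ->; rewrite hq //; lra.
Qed.

(** The members [a], [a'] are high for [z] and [b], [b'] low. Subtracting differences moves the high
    values, and [a.1 - b.1] is orthogonal to [a'.1 - b'.1], so both may be subtracted: all roots
    required by [no_split_colours] exist. *)
Lemma no_split_low s z a a' b b' : frame s ->
  a \in s -> a' \in s -> b \in s -> b' \in s -> b != b' -> z \in D ->
  dot z (a.1 - b.1) = q -> dot z (a.1 - b'.1) = q -> dot z (a'.1 - b.1) = q ->
  a.2 <> a'.2 -> a.2 <> b.2 -> a'.2 <> b.2 -> False.
Proof.
move=> fs sa sa' sb sb' nbb zD h1 h2 h3 m1 m2 m3.
have q0 := q_gt0 zD.
have h4 : dot z (a'.1 - b'.1) = q by move: h1 h2 h3; rewrite !dotBr; lra.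
have ne p p' : p.2 <> p'.2 -> p != p' by apply: contra_notN => /eqP ->.
have neq (p p' : 'rV[R]_r * T) : dot z (p.1 - p'.1) = q -> p != p'.
  by apply: contra_eqN => /eqP ->; rewrite subrr dotC dot0l; lra.
have n1 := neq _ _ h1; have n2 := neq _ _ h2; have n3 := neq _ _ h3; have n4 := neq _ _ h4.
have zab := frame_sub fs sa sb zD n1 h1.
apply: (no_split_colours fs sa sa' sb sb' _ _ _ m1 m2 m3 zD) => //;
  try exact: (frame_sub fs).
apply: (frame_sub fs sa' sb' zab n4).
rewrite eq_sym in n3; have n5 := ne _ _ m1.
by rewrite dotBl h4 (frame_dot0 fs) ?subr0.
Qed.

Lemma no_split s z a a' b b' t1 t2 t3 : frame s -> z \in D ->
  a \in s -> a' \in s -> b \in s -> b' \in s -> a != a' -> b != b' ->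
  dot z (a.1 - b.1) = q -> dot z (a.1 - a'.1) = 0 -> dot z (b.1 - b'.1) = 0 ->
  t1 \in s -> t2 \in s -> t3 \in s ->
  dot z (t1.1 - a.1) = 0 -> dot z (t2.1 - a.1) = 0 ->
  dot z (t3.1 - a.1) = 0 \/ dot z (t3.1 - b.1) = 0 ->
  t1.2 <> t2.2 -> t1.2 <> t3.2 -> t2.2 <> t3.2 -> False.
Proof.
move=> fs zD sa sa' sb sb' naa nbb hab haa hbb s1 s2 s3 h1 h2 h3 m12 m13 m23.
have q0 := q_gt0 zD.
have ne p p' : p.2 <> p'.2 -> p != p' by apply: contra_notN => /eqP ->.
case: h3 => h3; last first.
  have [c [sc nc hc]] : exists c, [/\ c \in s, t3 != c & dot z (t3.1 - c.1) = 0].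
    have [e|n] := eqVneq t3 b; last by exists b.
    by exists b'; rewrite e.
  by apply: (no_split_low fs s1 s2 s3 sc nc zD) m12 m13 m23;
    move: hab haa hbb h1 h2 h3 hc; rewrite !dotBr; lra.
have neq (p p' : 'rV[R]_r * T) : dot z (p.1 - p'.1) = q -> p != p'.
  by apply: contra_eqN => /eqP ->; rewrite subrr dotC dot0l; lra.
have d3b : dot z (t3.1 - b.1) = q by move: hab h3; rewrite !dotBr; lra.
have d3b' : dot z (t3.1 - b'.1) = q by move: hbb d3b; rewrite !dotBr; lra.
have d1b : dot z (t1.1 - b.1) = q by move: hab h1; rewrite !dotBr; lra.
have d1b' : dot z (t1.1 - b'.1) = q by move: hbb d1b; rewrite !dotBr; lra.
have d2b : dot z (t2.1 - b.1) = q by move: hab h2; rewrite !dotBr; lra.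
have d13 : dot z (t1.1 - t3.1) = 0 by move: d1b d3b; rewrite !dotBr; lra.
have d23 : dot z (t2.1 - t3.1) = 0 by move: d2b d3b; rewrite !dotBr; lra.
have [n3b n3b' n1b n1b' n2b] := And5 (neq _ _ d3b) (neq _ _ d3b') (neq _ _ d1b)
  (neq _ _ d1b') (neq _ _ d2b).
(* All three coloured members are high. Subtracting [t3.1 - b.1] exchanges the levels of [t3] and
   [b], so that [t3] becomes low. *)
have zD' := frame_sub fs s3 sb zD n3b d3b.
have n31 : t3 != t1 by apply: ne; exact: nesym.
have n32 : t3 != t2 by apply: ne; exact: nesym.
apply: (no_split_low fs s1 s2 s3 sb' n3b' zD') m12 m13 m23; rewrite dotBl.
- rewrite d13 -(opprB t3.1 t1.1) dotNr (frame_dotq fs) //; [lra | by rewrite eq_sym].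
- by rewrite d1b' (frame_dot0 fs) ?subr0 // eq_sym.
- rewrite d23 -(opprB t3.1 t2.1) dotNr (frame_dotq fs) //; [lra | by rewrite eq_sym].
Qed.

(** * Enlarging a family until it exhausts the roots *)

Definition frame_root s z := has (fun p => has (fun p' => (p != p') && (z == p.1 - p'.1)) s) s.

Lemma frame_rootP s z : reflect
  (exists p p', [/\ p \in s, p' \in s, p != p' & z = p.1 - p'.1]) (frame_root s z).
Proof.
apply: (iffP hasP) => [[p ps /hasP[p' ps' /andP[n /eqP e]]]|[p [p' [ps ps' n e]]]].
  by exists p, p'.
by exists p => //; apply/hasP; exists p'; rewrite // n e eqxx.
Qed.

Lemma frame_rootN s z : frame_root s (- z) = frame_root s z.
Proof.
apply/frame_rootP/frame_rootP => -[p [p' [ps ps' n e]]]; exists p', p.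
  by rewrite eq_sym -opprB -e opprK.
by rewrite eq_sym -opprB -e.
Qed.

(** The root [z] takes two values, differing by [q], on the family. If the high value is taken only
    at [p0], the new vector is [p0.1 - z]; if the low value is taken only at [p1], the same is done
    with [- z]; otherwise [no_split] gives a contradiction. *)
Lemma frame_step s z p0 p1 : frame s -> three_coloured s -> z \in D ->
  ~~ frame_root s z -> p0 \in s -> p1 \in s -> dot z (p0.1 - p1.1) != 0 ->
  exists2 p, p \notin s & frame (p :: s).
Proof.
move=> fs ts zD; wlog pos : z p0 p1 zD / 0 < dot z (p0.1 - p1.1).
  move=> hw nz s0 s1 n0; have [?|] := ltP 0 (dot z (p0.1 - p1.1)).
    exact: (hw z p0 p1).
  rewrite le_eqVlt (negPf n0) /= => neg; apply: (hw z p1 p0) => //.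
    by rewrite -opprB dotNr oppr_gt0.
  by rewrite -opprB dotNr oppr_eq0.
move=> nz s0 s1 _; have q0 := q_gt0 zD.
have n01 : p0 != p1 by apply: contraTneq pos => ->; rewrite subrr dotC dot0l ltxx.
have val p p' : p \in s -> p' \in s -> p != p' ->
    [\/ dot z (p.1 - p'.1) = - q, dot z (p.1 - p'.1) = 0 | dot z (p.1 - p'.1) = q].
  move=> sp sp' n; have pD := (fs p p' sp sp' n).1.
  apply: simply_laced => //; apply: contra nz => /eqP ->; first by apply/frame_rootP; exists p, p'.
  by rewrite frame_rootN; apply/frame_rootP; exists p, p'.
have h01 : dot z (p0.1 - p1.1) = q by case: (val p0 p1 s0 s1 n01) pos; lra.
have hl p : p \in s -> dot z (p.1 - p0.1) = 0 \/ dot z (p.1 - p1.1) = 0.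
  move=> sp; have [->|n0] := eqVneq p p0; first by left; rewrite subrr dotC dot0l.
  have [->|n1] := eqVneq p p1; first by right; rewrite subrr dotC dot0l.
  move: h01; have := val p p0 sp s0 n0; have := val p p1 sp s1 n1; rewrite !dotBr.
  by case=> h [] h' h01; first [left; lra | right; lra].
have ext u p (w := p.1 - u) : p \in s -> u \in D -> ~~ frame_root s u ->
    (forall p', p' \in s -> p' != p -> dot u (p.1 - p'.1) = q) ->
    exists2 p, p \notin s & frame (p :: s).
  move=> sp uD nu hu.
  have [|c fc] := frame_extend fs ts sp uD.
    by move=> p' sp' n; apply: (frame_sub fs); rewrite 1?eq_sym // hu.
  exists (p.1 - u, c) => //; apply: contra nu => sw.
  apply/frame_rootP; exists p, (p.1 - u, c); split=> //=; last by vring.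
  (* If the new vector were already in the family, [u] would be one of its differences; the two
     members are distinct because [u] is not zero. *)
  apply: contraTneq (root_neq0 hD uD) => e; rewrite negbK; have := congr1 fst e.
  by move=> /= /eqP; rewrite eq_sym subr_eq addrC -subr_eq subrr eq_sym.
have [/hasP[a sa /andP[na /eqP ha]]|n0] :=
    boolP (has (fun p => (p != p0) && (dot z (p.1 - p0.1) == 0)) s); last first.
  apply: (ext z p0) => // p sp np; have [h|h] := hl p sp.
    by case/hasP: n0; exists p; rewrite // np h eqxx.
  by move: h01 h; rewrite !dotBr; lra.
have [/hasP[b sb /andP[nb /eqP hb]]|n1] :=
    boolP (has (fun p => (p != p1) && (dot z (p.1 - p1.1) == 0)) s); last first.
  apply: (ext (- z) p1) => //; rewrite ?root_oppE ?frame_rootN // => p sp np.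
  have [h|h] := hl p sp; last by case/hasP: n1; exists p; rewrite // np h eqxx.
  by move: h01 h; rewrite dotNl !dotBr; lra.
(* Of three members with distinct colours, two lie on the same level; [hi] treats the high level and
   [low] the low one, through [- z]. *)
exfalso; have [t1 [t2 [t3 [st1 st2 st3 [m12 m13 m23]]]]] := ts.
have m21 := nesym m12; have m31 := nesym m13; have m32 := nesym m23.
have hi u1 u2 u3 : u1 \in s -> u2 \in s -> u3 \in s ->
    dot z (u1.1 - p0.1) = 0 -> dot z (u2.1 - p0.1) = 0 ->
    u1.2 <> u2.2 -> u1.2 <> u3.2 -> u2.2 <> u3.2 -> False.
  move=> su1 su2 su3 e1 e2; rewrite eq_sym in na; rewrite eq_sym in nb.
  apply: (no_split fs zD s0 sa s1 sb na nb h01) (hl _ su3) => //.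
    by rewrite -opprB dotNr ha oppr0.
  by rewrite -opprB dotNr hb oppr0.
have low u1 u2 u3 : u1 \in s -> u2 \in s -> u3 \in s ->
    dot z (u1.1 - p1.1) = 0 -> dot z (u2.1 - p1.1) = 0 ->
    u1.2 <> u2.2 -> u1.2 <> u3.2 -> u2.2 <> u3.2 -> False.
  move=> su1 su2 su3 e1 e2; rewrite eq_sym in na; rewrite eq_sym in nb.
  have zD' := root_opp hD zD.
  apply: (no_split fs zD' s1 sb s0 sa nb na) => //; rewrite dotNl.
  - by rewrite -dotNr opprB.
  - by rewrite -dotNr opprB.
  - by rewrite -dotNr opprB.
  - by rewrite e1 oppr0.
  - by rewrite e2 oppr0.
  by have [h|h] := hl _ su3; [right | left]; rewrite ?dotNl h oppr0.
have [h1|h1] := hl _ st1; have [h2|h2] := hl _ st2; have [h3|h3] := hl _ st3;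
  by [apply: (hi t1 t2 t3) | apply: (hi t1 t3 t2) | apply: (hi t2 t3 t1)
     | apply: (low t1 t2 t3) | apply: (low t1 t3 t2) | apply: (low t2 t3 t1)].
Qed.

(** The differences from [p0] are distinct and lie in [D] with 0 added. This bound makes the
    enlargement process stop. *)
Lemma frame_size s p0 : uniq s -> frame s -> p0 \in s -> (size s <= #|` D|.+1)%N.
Proof.
move=> us fs s0; rewrite -(size_map (fun p => p0.1 - p.1)).
apply: (@leq_trans (size (0 :: enum_fset D))); last by [].
apply: uniq_leq_size.
  rewrite map_inj_in_uniq // => p p' sp sp' /addrI /oppr_inj e.
  apply: contraTeq isT => n; have := (fs p p' sp sp' n).1.
  by rewrite e subrr => /(root_neq0 hD); rewrite eqxx.
move=> _ /mapP[p sp ->]; have [->|n] := eqVneq p0 p; first by rewrite subrr mem_head.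
by rewrite inE; apply/orP; right; exact: (fs p0 p s0 sp n).1.
Qed.

(** When no enlargement is possible, every root that is not a difference is orthogonal to all
    differences, and irreducibility concludes. *)
Lemma frame_full s : uniq s -> frame s -> three_coloured s ->
  exists s', [/\ uniq s', frame s', three_coloured s' &
    forall z, z \in D -> frame_root s' z].
Proof.
have [k] := ubnP (#|` D|.+1 - size s)%N; elim: k s => // k IH s hk us fs ts.
have [p1 [p2 [_ [s1 s2 _ [m12 _ _]]]]] := ts.
have n12 : p1 != p2 by apply: contra_notN m12 => /eqP ->.
have [/hasP[z zD /andP[nz /hasP[p0 s0 /hasP[p0' s0' n0]]]]|nex] :=
  boolP (has (fun z => ~~ frame_root s z &&
    has (fun p => has (fun p' => dot z (p.1 - p'.1) != 0) s) s) D).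
  have [p np fp] := frame_step fs ts zD nz s0 s0' n0.
  apply: (IH (p :: s)) => //=; last 2 first.
  - by rewrite np us.
  - have [t1 [t2 [t3 [st1 st2 st3 m]]]] := ts.
    by exists t1, t2, t3; rewrite !inE st1 st2 st3 !orbT.
  have := @frame_size (p :: s) p _ fp (mem_head _ _); rewrite /= np us => /(_ isT) le.
  by rewrite -ltnS; apply: leq_trans hk; rewrite ltnS ltn_sub2lE.
exists s; split=> // z; apply: (irreducible_ind hirr).
  exists (p1.1 - p2.1); first exact: (fs p1 p2 s1 s2 n12).1.
  by apply/frame_rootP; exists p1, p2.
move=> x y xD yD /frame_rootP[p [p' [sp sp' _ ->]]] ny; rewrite dotC.
apply/eqP; apply: contraNT nex => ne; apply/hasP; exists y => //; rewrite ny.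
by apply/hasP; exists p => //; apply/hasP; exists p'.
Qed.

End Frames.

(** * Type A as differences of vectors *)

Record full_frame (R : rcfType) (r : nat) (D : {fset 'rV[R]_r}) (q : R)
    (n : nat) (E : 'I_n.+1 -> 'rV[R]_r) : Prop := FullFrame {
  ff_pos : 0 < q;
  ff_mem : forall x, x \in D <-> exists i j, i != j /\ x = E i - E j;
  ff_norm : forall i j, i != j -> dot (E i - E j) (E i - E j) = 2 * q
}.

Lemma colouring_full_frame (R : rcfType) (r : nat) (D : {fset 'rV[R]_r})
    (T : eqType) (col : 'rV[R]_r -> T) z1 z2 z3 :
  root_system D -> irreducible D ->
  (forall x y, x \in D -> y \in D -> x + y \in D ->
    col (x + y) = col x \/ col (x + y) = col y) ->
  z1 \in D -> z2 \in D -> z3 \in D ->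
  col z1 != col z2 -> col z1 != col z3 -> col z2 != col z3 ->
  exists (n : nat) (q : R) (E : 'I_n.+1 -> 'rV[R]_r) (c : 'I_n.+1 -> T),
    [/\ (2 <= n)%N, full_frame D q E & forall i j, i != j -> col (E i - E j) = c i].
Proof.
move=> hD hirr hcol z1D z2D z3D n12 n13 n23.
have [x [y [xD yD h xy]]] := hex_exists hD hirr hcol z1D z2D z3D n12 n13 n23.
pose q := dot x x / 2.
have hq z : z \in D -> dot z z = 2 * q.
  by move=> zD; rewrite (norm_const hD hirr hcol xD yD h xy zD) /q; field.
have [xyD _ _] := hex_cartan hD hcol xD yD h xy.
have [h1 h2] := hex_sum hD hcol xD yD xyD h.
have /hexP[a1 a2 a3 a4] := h.
have nxD := root_opp hD xD; have nyD := root_opp hD yD; have nxyD := root_opp hD xyD.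
(* The six differences of [x], 0 and [- y] are the roots of the hexagon of [x] and [y], with the
   colours required. *)
pose s := [:: (x, col x); (0, col y); (- y, col (- y))].
have fs : frame D col s.
  move=> p p'; rewrite !inE.
  by case/or3P => /eqP ->; case/or3P => /eqP -> /=; rewrite ?eqxx // => _;
    rewrite ?subr0 ?sub0r ?opprK -?opprD ?(addrC y x).
have us : uniq s.
  rewrite /= !inE !xpair_eqE !negb_or !negb_and !andbT.
  apply/andP; split; first (apply/andP; split); apply/orP; right; apply/eqP => //.
  by congruence.
have [|s' [us' fs' [p1 [p2 [p3 [s1 s2 s3 [m12 m13 m23]]]]] full]] :=
    frame_full hD hirr hcol hq us fs.
  exists (x, col x), (0, col y), (- y, col (- y)); rewrite !inE !eqxx !orbT.
  by split=> //; split=> //=; congruence.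
have ne p p' : p.2 <> p'.2 -> p != p' by apply: contra_notN => /eqP ->.
have sz : (3 <= size s')%N.
  have : uniq [:: p1; p2; p3].
    by rewrite /= !inE !negb_or; do !(apply/andP; split) => //; exact: ne.
  move/uniq_leq_size => /(_ s'); apply=> p; rewrite !inE.
  by case/or3P => /eqP ->.
case es : (size s') sz => [//|n] sz.
have ns (i : 'I_n.+1) : nth p1 s' i \in s' by rewrite mem_nth // es.
have nn (i j : 'I_n.+1) : i != j -> nth p1 s' i != nth p1 s' j.
  by rewrite nth_uniq ?es.
exists n, q, (fun i => (nth p1 s' i).1), (fun i => (nth p1 s' i).2); split => //.
  split; first exact: (q_gt0 hD hq xD).
    move=> z; split=> [/full /frame_rootP[p [p' [ps ps' n0 ->]]]|[i [j [nij ->]]]].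
      have ip : (index p s' < n.+1)%N by rewrite -es index_mem.
      have ip' : (index p' s' < n.+1)%N by rewrite -es index_mem.
      exists (Ordinal ip), (Ordinal ip'); rewrite /= !nth_index //; split=> //.
      apply: contra n0 => /eqP [e].
      by rewrite -(nth_index p1 ps) e nth_index.
    exact: (fs' _ _ (ns i) (ns j) (nn _ _ nij)).1.
  by move=> i j nij; apply: hq; exact: (fs' _ _ (ns i) (ns j) (nn _ _ nij)).1.
by move=> i j nij; rewrite (fs' _ _ (ns i) (ns j) (nn _ _ nij)).2.
Qed.

Section FullFrame.

Variables (R : rcfType) (r : nat) (D : {fset 'rV[R]_r}) (q : R) (n : nat).
Variable E : 'I_n.+1 -> 'rV[R]_r.
Hypothesis hE : full_frame D q E.
Implicit Types i j k l : 'I_n.+1.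

Lemma full_frame_in i j : i != j -> E i - E j \in D.
Proof. by move=> nij; apply/(ff_mem hE); exists i, j. Qed.

Lemma full_frame_dot i j k l : dot (E i - E j) (E k - E l) =
  q * ((i == k)%:R + (j == l)%:R - (i == l)%:R - (j == k)%:R).
Proof.
have nrm a b : dot (E a - E b) (E a - E b) = 2 * q * (1 - (a == b)%:R).
  have [->|nab] := eqVneq a b; first by rewrite !subrr dot0l mulr0.
  by rewrite subr0 mulr1 (ff_norm hE nab).
have := dot_polar (E i) (E j) (E k) (E l); rewrite !nrm; lra.
Qed.

(** For a combination of the [E i] whose coefficients sum to zero, this linear functional returns
    the coefficient of [E a]. *)
Definition frame_coord a x := (\sum_(b < n.+1) dot x (E a - E b)) / (q * n.+1%:R).

Lemma sum_eq_natr k : \sum_(b < n.+1) (k == b)%:R = 1 :> R.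
Proof.
by rewrite (bigD1 k) //= eqxx big1 ?addr0 // => b; rewrite eq_sym => /negPf ->.
Qed.

Lemma frame_coordE a i j : frame_coord a (E i - E j) = (a == i)%:R - (a == j)%:R.
Proof.
have q0 := ff_pos hE; have n0 : 0 < n.+1%:R :> R by rewrite ltr0Sn.
rewrite /frame_coord; under eq_bigr do rewrite full_frame_dot.
rewrite -mulr_sumr sumrB sumrB big_split /= !sumr_const card_ord !sum_eq_natr.
rewrite -(mulr_natl _ n.+1) -(mulr_natl (j == a)%:R) (eq_sym a) (eq_sym a).
by field; rewrite nat1r !gt_eqF.
Qed.

Lemma frame_coordD a x y : frame_coord a (x + y) = frame_coord a x + frame_coord a y.
Proof.
by rewrite /frame_coord -mulrDl -big_split; congr (_ / _); apply: eq_bigr => b _; exact: dotDl.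
Qed.

Lemma frame_coordZ a c x : frame_coord a (c *: x) = c * frame_coord a x.
Proof.
rewrite /frame_coord mulrA mulr_sumr; congr (_ / _).
by apply: eq_bigr => b _; exact: dotZl.
Qed.

Lemma frame_coord0 a : frame_coord a 0 = 0.
Proof. by rewrite -(scale0r 0) frame_coordZ mul0r. Qed.

Lemma frame_coord_sum a (I : Type) (s : seq I) (P : pred I) F :
  frame_coord a (\sum_(i <- s | P i) F i) = \sum_(i <- s | P i) frame_coord a (F i).
Proof.
exact: (big_morph (frame_coord a) (fun x y => frame_coordD a x y) (frame_coord0 a)).
Qed.

Lemma full_frame_inj i j k l : i != j -> E i - E j = E k - E l -> i = k /\ j = l.
Proof.
move=> nij e; have ci := frame_coordE i i j; have cj := frame_coordE j i j.
have nji : j != i by rewrite eq_sym.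
move: ci cj; rewrite {}e !frame_coordE !eqxx (negPf nij) (negPf nji).
have [->|_] := eqVneq i k; have [->|_] := eqVneq j l => //;
  do 2 case: eqP => _; move=> /= *; exfalso; lra.
Qed.

(** The coordinate of the sum at [a] is 1, hence positive in one of the summands. *)
Lemma full_frame_rule i j k l a b : a != b ->
  (E i - E j) + (E k - E l) = E a - E b -> a = i \/ a = k.
Proof.
move=> nab /(congr1 (frame_coord a)); rewrite frame_coordD !frame_coordE eqxx (negPf nab).
have [->|_] := eqVneq a i; first by left.
have [->|_] := eqVneq a k; first by right.
do 2 case: eqP => _; move=> /= *; exfalso; lra.
Qed.

Lemma full_frame_opp : full_frame D q (fun i => - E i).
Proof.
split; first exact: ff_pos hE.
  move=> x; split=> [/(ff_mem hE)|] [i [j [nij ->]]].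
    by exists j, i; rewrite eq_sym opprK addrC.
  by rewrite opprK addrC full_frame_in // eq_sym.
by move=> i j nij; rewrite opprK addrC (ff_norm hE) // eq_sym.
Qed.

End FullFrame.

Lemma inord_eq n k l : (k <= n)%N -> (l <= n)%N ->
  (inord k == inord l :> 'I_n.+1) = (k == l).
Proof. by move=> kn ln; rewrite -val_eqE /= !inordK. Qed.

(** * Simple roots obtained from a full family *)

Section TypeABase.

Variables (R : rcfType) (r : nat) (D : {fset 'rV[R]_r}) (q : R) (n : nat).
Variable E : 'I_n.+1 -> 'rV[R]_r.
Hypotheses (hD : root_system D) (hE : full_frame D q E).

Let a (k : nat) := E (inord k) - E (inord k.+1).

Lemma full_frame_telescope i j : (i <= j)%N -> (j <= n)%N ->
  E (inord i) - E (inord j) = \sum_(k < n) a k *~ ((i <= k < j)%N : nat).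
Proof.
move=> ij jn; transitivity (\sum_(i <= k < j) a k).
  have := telescope_sumr (fun k => - E (inord k)) ij.
  rewrite opprK addrC => <-; apply: eq_bigr => k _.
  by rewrite /a opprK addrC.
rewrite (big_nat_widenl i 0) // (big_nat_widen _ _ n) // big_mkord big_mkcond /=.
by apply: eq_bigr => k _; case: (i <= k < j)%N.
Qed.

Lemma typeA_full_frame : typeA_base D [tuple a k | k < n].
Proof.
have pa i j : (i < n)%N -> (j < n)%N -> dot (a i) (a j) =
    q * ((i == j)%:R + (i == j)%:R - (i == j.+1)%:R - (i.+1 == j)%:R).
  move=> hi hj; rewrite (full_frame_dot hE) !inord_eq // ?eqSS //; exact: ltnW.
have q0 := ff_pos hE.
split; last first.
  move=> i j; rewrite !tnth_mktuple /cartan !pa // -val_eqE /=.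
  have s1 k : (k == k.+1) = false by rewrite ltn_eqF.
  have s2 k : (k.+1 == k) = false by rewrite gtn_eqF.
  rewrite !eqxx !s1 !s2 !subr0 (eq_sym j.+1).
  have [->|nij] := eqVneq (i : nat) j.
    by rewrite s1 s2 !subr0 /=; field; rewrite gt_eqF.
  rewrite orbC; have [e|nij1] := eqVneq (i : nat) j.+1.
    by rewrite e (gtn_eqF (leqnSn _)) /=; field; rewrite gt_eqF.
  by have [e|nij2] := eqVneq i.+1 j; rewrite /=; field; rewrite gt_eqF.
have span x : x \in D -> exists k : 'I_n -> int,
    x = \sum_(i < n) a i *~ k i /\ ((forall i, 0 <= k i) \/ (forall i, k i <= 0)).
  move/(ff_mem hE) => [i [j [nij ->]]].
  have hi := ltn_ord i; have hj := ltn_ord j; rewrite !ltnS in hi hj.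
  have [ij|/ltnW ji] := leqP i j.
    exists (fun k => ((i <= k < j)%N : nat)); rewrite -full_frame_telescope //.
    by rewrite !inord_val; split=> //; left.
  exists (fun k => - (((j <= k < i)%N : nat) : int)); split; last first.
    by right=> k; rewrite oppr_le0.
  under eq_bigr do rewrite mulrNz; rewrite sumrN -full_frame_telescope //.
  by rewrite !inord_val opprB.
split.
- move=> x /tnthP[i ->]; rewrite tnth_mktuple; apply: (full_frame_in hE).
  by rewrite inord_eq ?ltn_eqF //; exact: ltnW.
- apply/andP; split.
  + rewrite eqEsubv subvf -(rs_span hD); apply/span_subvP => x /span[k [-> _]].
    apply: rpred_sum => i _; rewrite -scaler_int; apply/rpredZ/memv_span.
    by apply/tnthP; exists i; rewrite tnth_mktuple.
  + apply/freeP => c hc i.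
    (* The sum of the coordinates of index at most [i] is 1 on the simple root [i] and 0 on the
       others, so it isolates [c i]. *)
    have om (k : nat) : (k < n.+1)%N ->
        \sum_(b < n.+1 | (b <= i)%N) (b == inord k)%:R = (k <= i)%:R :> R.
      move=> kn; rewrite big_mkcond (bigD1 (inord k)) //= inordK // eqxx big1 ?addr0.
        by case: ifP.
      by move=> b /negPf ->; case: ifP.
    have dual (k : 'I_n) : \sum_(b < n.+1 | (b <= i)%N)
        frame_coord q E b (c k *: [tuple a k | k < n]`_k) = c k * (k == i)%:R.
      under eq_bigr do rewrite frame_coordZ -tnth_nth tnth_mktuple (frame_coordE hE).
      rewrite -mulr_sumr sumrB !om ?ltnS //; last exact: ltnW.
      rewrite (leq_eqVlt k) val_eqE.
      by have [->|_] := eqVneq k i; rewrite ?ltnn ?subr0 ?subrr.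
    have : \sum_(b < n.+1 | (b <= i)%N) frame_coord q E b 0 = 0.
      by rewrite big1 // => b _; exact: frame_coord0.
    rewrite -hc; under eq_bigr do rewrite frame_coord_sum.
    rewrite exchange_big /=; under eq_bigr do rewrite dual.
    rewrite (bigD1 i) //= eqxx mulr1 big1 ?addr0 // => k /negPf ->.
    by rewrite mulr0.
- move=> x /span[k [-> hk]]; exists k; split=> //.
  by apply: eq_bigr => i _; rewrite tnth_mktuple.
Qed.
End TypeABase.

Lemma full_frame_reflection (R : rcfType) (r : nat) (D : {fset 'rV[R]_r}) (q : R)
    (n : nat) (E : 'I_n.+1 -> 'rV[R]_r) i j k l :
  full_frame D q E -> i != j ->
  reflection (E i - E j) (E k - E l) = E (tperm i j k) - E (tperm i j l).
Proof.
move=> hE nij.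
have tE m : E (tperm i j m) = E m - ((m == i)%:R - (m == j)%:R) *: (E i - E j).
  case: tpermP => [->|->|/eqP/negPf -> /eqP/negPf ->].
  - by rewrite eqxx (negPf nij) subr0 scale1r opprB addrC subrK.
  - by rewrite eqxx eq_sym (negPf nij) sub0r scaleN1r opprK addrC subrK.
  - by rewrite subrr scale0r subr0.
have q0 := ff_pos hE.
rewrite !tE /reflection.
have -> : cartan (E k - E l) (E i - E j) =
    ((k == i)%:R - (k == j)%:R) - ((l == i)%:R - (l == j)%:R).
  rewrite /cartan (ff_norm hE nij) (full_frame_dot hE); field.
  by rewrite gt_eqF.
rewrite [X in _ - X = _]scalerBl; vring.
Qed.

(** These are the values in [full_frame_dot] for roots sharing neither first nor second index, and
    for roots sharing only the first. *)
Lemma sub_bools_neq1 (R : rcfType) (b c : bool) :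
  false%:R + false%:R - b%:R - c%:R <>
  true%:R + false%:R - false%:R - false%:R :> R.
Proof. by case: b; case: c => /=; lra. Qed.

Lemma inj_surj_bij (S T : finType) (f : S -> T) :
  injective f -> (forall y, exists x, f x = y) -> bijective f.
Proof.
move=> fi fs; apply: inj_card_bij => //; rewrite -(card_codom fi).
by apply: subset_leq_card; apply/subsetP => y _; have [x <-] := fs y; exact: codom_f.
Qed.

Lemma full_frame_injective (R : rcfType) (r : nat) (D : {fset 'rV[R]_r}) (q : R) (n : nat)
    (E : 'I_n.+1 -> 'rV[R]_r) : full_frame D q E -> injective E.
Proof.
move=> hE i j e; apply/eqP; apply: contraT => nij.
by have := ff_norm hE nij; rewrite e subrr dot0l; have := ff_pos hE; lra.
Qed.

(** * Uniqueness of the family up to translation, sign and numbering *)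

Section TwoFrames.

Variables (R : rcfType) (r : nat) (D : {fset 'rV[R]_r}) (q : R) (N : nat).
Variables (e : 'I_N.+1 -> 'rV[R]_r).
Hypotheses (he : full_frame D q e).

(** Two roots [e ord0 - e a] have product [q], so in terms of [E] they share a first or a second
    index. Given two with a common first index, a third with another first index would share its
    second index with both, making them equal. So [I] is constant and [J] gives the numbering. *)
Lemma full_frame_match (n : nat) (E : 'I_n.+1 -> 'rV[R]_r) (I J : 'I_N.+1 -> 'I_n.+1) a1 a2 :
  full_frame D q E ->
  (forall a, a != ord0 -> I a != J a /\ e ord0 - e a = E (I a) - E (J a)) ->
  a1 != ord0 -> a2 != ord0 -> a1 != a2 -> I a1 = I a2 ->
  exists s : 'I_N.+1 -> 'I_n.+1, bijective s /\
    forall i j, e i - e j = E (s i) - E (s j).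
Proof.
move=> hE hIJ n1 n2 n12 I12; have q0 := ff_pos hE.
have share a b : a != ord0 -> b != ord0 -> a != b -> I a != I b -> J a = J b.
  move=> na nb nab nI; apply/eqP; apply: contraT => nJ.
  have [_ ea] := hIJ a na; have [_ eb] := hIJ b nb.
  have := full_frame_dot he ord0 a ord0 b; rewrite ea eb (full_frame_dot hE).
  rewrite (negPf nI) (negPf nJ) (negPf nab) (negPf na) (eq_sym ord0) (negPf nb) eqxx.
  by move/(mulfI (lt0r_neq0 q0)) => /sub_bools_neq1.
have It b : b != ord0 -> I b = I a1.
  move=> nb; apply/eqP; apply: contraT => nI.
  have nb1 : b != a1 by apply: contraNneq nI => ->.
  have nb2 : b != a2 by apply: contraNneq nI => ->; rewrite I12.
  have j1 := share b a1 nb n1 nb1 nI; rewrite I12 in nI.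
  have j2 := share b a2 nb n2 nb2 nI.
  have [_ e1] := hIJ a1 n1; have [_ e2] := hIJ a2 n2.
  move: e2; rewrite -I12 -j2 j1 -e1 => /addrI/oppr_inj/(full_frame_injective he) e12.
  by rewrite e12 eqxx in n12.
pose s a := if a == ord0 then I a1 else J a.
have es0 a : e ord0 - e a = E (I a1) - E (s a).
  rewrite /s; have [->|na] := eqVneq a ord0; first by rewrite !subrr.
  by have [_ ->] := hIJ a na; rewrite It.
have es i j : e i - e j = E (s i) - E (s j).
  have -> : e i - e j = (e ord0 - e j) - (e ord0 - e i) by vring.
  by rewrite !es0; vring.
exists s; split=> //; apply: inj_surj_bij => [i j sij|k].
  by apply: (full_frame_injective he); apply/eqP; rewrite -subr_eq0 es sij subrr.
have [->|nk] := eqVneq k (I a1); first by exists ord0; rewrite /s eqxx.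
have /(ff_mem he)[i [j [nij]]] := full_frame_in hE nk.
by rewrite es => /(full_frame_inj hE nk)[-> _]; exists i.
Qed.

(** As [2 <= N], there are two roots [e ord0 - e a] to compare. If they share the first index in
    [E], [full_frame_match] applies; otherwise they share the second, and it applies to the opposite
    family. *)
Lemma full_frame_unique (q' : R) (n : nat) (E : 'I_n.+1 -> 'rV[R]_r) :
  (2 <= N)%N -> full_frame D q' E ->
  exists (b : bool) (s : 'I_N.+1 -> 'I_n.+1), bijective s /\
    forall i j, e i - e j = (-1) ^+ b *: (E (s i) - E (s j)).
Proof.
move=> N2 hE'.
have n1 : (inord 1 : 'I_N.+1) != ord0 by rewrite -val_eqE /= inordK //; lia.
have n2 : (inord 2 : 'I_N.+1) != ord0 by rewrite -val_eqE /= inordK.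
have n12 : (inord 1 : 'I_N.+1) != inord 2 by rewrite inord_eq //; lia.
have hE : full_frame D q E.
  suff -> : q = q' by [].
  have /(ff_mem hE')[i [j [nij eij]]] := full_frame_in he n1.
  by have := ff_norm he n1; rewrite eij (ff_norm hE' nij); lra.
pose IJ a := odflt (ord0, ord0) [pick p : 'I_n.+1 * 'I_n.+1 |
  (p.1 != p.2) && (e ord0 - e a == E p.1 - E p.2)].
have hIJ a : a != ord0 -> (IJ a).1 != (IJ a).2 /\
    e ord0 - e a = E (IJ a).1 - E (IJ a).2.
  move=> na; rewrite /IJ; case: pickP => [p /andP[? /eqP]//|nex].
  rewrite eq_sym in na; have /(ff_mem hE)[i [j [nij eij]]] := full_frame_in he na.
  by have := nex (i, j); rewrite /= nij eij eqxx.
have [e1|ne1] := eqVneq (IJ (inord 1)).1 (IJ (inord 2)).1.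
  have [s [sb hs]] := full_frame_match hE hIJ n1 n2 n12 e1.
  by exists false, s; split=> // i j; rewrite scale1r.
have hEo := full_frame_opp hE.
have hJI a : a != ord0 -> (IJ a).2 != (IJ a).1 /\
    e ord0 - e a = - E (IJ a).2 - - E (IJ a).1.
  by move=> /hIJ [? ->]; rewrite eq_sym opprK addrC.
have e2 : (IJ (inord 1)).2 = (IJ (inord 2)).2.
  apply/eqP; apply: contraT => ne2.
  have [_ ea] := hIJ _ n1; have [_ eb] := hIJ _ n2; have q0 := ff_pos hE.
  have := full_frame_dot he ord0 (inord 1) ord0 (inord 2); rewrite ea eb (full_frame_dot hE).
  rewrite (negPf ne1) (negPf ne2) (negPf n12) (negPf n1) (eq_sym ord0) (negPf n2) eqxx.
  by move/(mulfI (lt0r_neq0 q0)) => /sub_bools_neq1.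
have [s [sb hs]] := full_frame_match hEo hJI n1 n2 n12 e2.
by exists true, s; split=> // i j; rewrite hs scaleN1r opprB opprK addrC.
Qed.

End TwoFrames.

(** * The full family attached to a base of type A *)

Section TypeAFrame.

Variables (R : rcfType) (r : nat) (D : {fset 'rV[R]_r}) (n : nat).
Variable alpha : n.+1.-tuple 'rV[R]_r.
Hypotheses (hD : root_system D) (hA : typeA_base D alpha).

Let al (k : nat) := alpha`_k.
Let q := dot (al 0%N) (al 0%N) / 2.

Let al_in k : (k < n.+1)%N -> al k \in D.
Proof.
by case: hA => -[sub _ _] _ kn; apply: sub; rewrite mem_nth // size_tuple.
Qed.

Let al_cartan j k : (j < n.+1)%N -> (k < n.+1)%N -> cartan (al j) (al k) =
  if j == k then 2 else if (j.+1 == k) || (k.+1 == j) then -1 else 0.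
Proof.
move=> hj hk; case: hA => _ /(_ (Ordinal hj) (Ordinal hk)).
by rewrite !(tnth_nth 0) -val_eqE.
Qed.

Let al_norm k : (k < n.+1)%N -> dot (al k) (al k) = 2 * q.
Proof.
elim: k => [_|k IH hk]; first by rewrite /q; field.
have hk' := ltnW hk; rewrite -IH //.
have := cartan_dot (al k) (root_neq0 hD (al_in hk)).
have := cartan_dot (al k.+1) (root_neq0 hD (al_in hk')).
rewrite !al_cartan // eqxx orbT (ltn_eqF (ltnSn k)) (gtn_eqF (ltnSn k)) /=.
by rewrite (dotC (al k.+1)); lra.
Qed.

Let q_gt0 : 0 < q.
Proof. have := root_norm_gt0 hD (al_in (ltn0Sn n)); rewrite al_norm //; lra. Qed.

Let al_dot j k : (j < n.+1)%N -> (k < n.+1)%N -> dot (al j) (al k) =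
  if j == k then 2 * q else if (j.+1 == k) || (k.+1 == j) then - q else 0.
Proof.
move=> hj hk; have := cartan_dot (al j) (root_neq0 hD (al_in hk)).
rewrite al_cartan // al_norm //.
by case: ifP => _; [|case: ifP => _]; lra.
Qed.

Let b (m : nat) : 'rV[R]_r := \sum_(k < n.+1 | (k < m)%N) tnth alpha k.

Let bS m : (m < n.+1)%N -> b m.+1 = b m + al m.
Proof.
move=> hm; rewrite /b (bigD1 (Ordinal hm)) //= addrC (tnth_nth 0); congr (_ + _).
by apply: eq_bigl => k; rewrite ltnS (ltn_neqAle _ m) andbC.
Qed.

(** Induction on [j]: the product of [b j - b i] with [al j] is [- q], so the reflection in [al j]
    adds [al j]. The third clause carries these products along. *)
Let b_sub i j : (i < j)%N -> (j <= n.+1)%N ->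
  [/\ b j - b i \in D, dot (b j - b i) (b j - b i) = 2 * q
    & forall k, (j <= k)%N -> (k < n.+1)%N ->
      dot (b j - b i) (al k) = if j == k then - q else 0].
Proof.
elim: j => // j IH; rewrite ltnS leq_eqVlt => /predU1P[<-|ij] hj.
  rewrite bS // addrAC subrr add0r; split; [exact: al_in|exact: al_norm|].
  by move=> k jk hk; rewrite al_dot // (ltn_eqF jk) (gtn_eqF (leqW jk)) orbF.
have [h1 h2 h3] := IH ij (ltnW hj).
have aj := al_in hj; have e : b j.+1 - b i = (b j - b i) + al j by rewrite bS // addrAC.
have hjj := h3 j (leqnn _) hj; rewrite eqxx in hjj.
rewrite e; split.
- have := rs_reflection hD aj h1; rewrite /reflection.
  suff -> : cartan (b j - b i) (al j) = -1 by rewrite scaleN1r opprK.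
  by rewrite /cartan hjj al_norm //; field; rewrite gt_eqF.
- by rewrite [LHS]dotDl !(dotDr (b j - b i) (al j)) (dotC (al j)) hjj h2 al_norm //; lra.
- move=> k jk hk; rewrite dotDl h3 ?(ltnW jk) // al_dot // !(ltn_eqF jk) (gtn_eqF (leqW jk)).
  by rewrite orbF add0r.
Qed.

(** With this sign the differences starting at [E i] are the members of [max_part alpha i]. *)
Let E (i : 'I_n.+2) := - beta alpha i.

Let E_sub i j : i != j -> E i - E j \in D /\ dot (E i - E j) (E i - E j) = 2 * q.
Proof.
have sub k l : (k < l)%N -> (l <= n.+1)%N -> 
    b l - b k \in D /\ dot (b l - b k) (b l - b k) = 2 * q.
  by move=> kl hl; have [] := b_sub kl hl.
rewrite /E opprK (_ : beta alpha i = b i) // (_ : beta alpha j = b j) //.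
have hi := ltn_ord i; have hj := ltn_ord j; rewrite !ltnS in hi hj.
rewrite -val_eqE neq_ltn => /orP[ij|ji]; rewrite addrC; first exact: sub.
by rewrite -opprB root_oppE // dotNl dotNr opprK; exact: sub.
Qed.

Let Phi : {fset 'rV[R]_r} := [fset E p.1 - E p.2 | p in [pred p : 'I_n.+2 * 'I_n.+2 | p.1 != p.2]].

Let Phi_frame : full_frame Phi q E.
Proof.
split=> // [x|i j /E_sub[]//]; split=> [/imfsetP[[i j] /= nij ->]|[i [j [nij ->]]]].
  by exists i, j.
by apply/imfsetP; exists (i, j).
Qed.

Let alE (k : 'I_n.+1) : tnth alpha k = E (inord k) - E (inord k.+1).
Proof.
have hk := ltn_ord k; rewrite /E opprK addrC.
have bE m : (m < n.+2)%N -> beta alpha (inord m) = b m.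
  by move=> hm; rewrite /beta /b; under eq_bigl do rewrite inordK //.
by rewrite (bE k) 1?ltnW // (bE k.+1) // bS // addrC addrA addNr add0r /al -tnth_nth.
Qed.

Let al_neq (k : 'I_n.+1) : (inord k : 'I_n.+2) != inord k.+1.
Proof. by rewrite inord_eq ?ltn_eqF //; exact: ltnW. Qed.

Let Phi_reflection (k : 'I_n.+1) x : x \in Phi -> reflection (tnth alpha k) x \in Phi.
Proof.
case/(ff_mem Phi_frame) => [i [j [nij ->]]].
rewrite alE (full_frame_reflection _ _ Phi_frame) //; apply: (full_frame_in Phi_frame).
by rewrite (inj_eq perm_inj).
Qed.

Let free_alpha : free alpha.
Proof. by case: hA => -[_ /andP[]]. Qed.

Let c (i : 'I_n.+1) (x : 'rV[R]_r) : R := coord alpha i x.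

Let c_sum x : x = \sum_i c i x *: tnth alpha i.
Proof.
have /andP[/eqP sp _] : basis_of fullv alpha by case: hA => -[].
have := @coord_span _ _ _ alpha x; rewrite sp memvf => /(_ isT) {1}->.
by apply: eq_bigr => i _; rewrite -tnth_nth.
Qed.

Let cZB i x k (a : R) : c i (x - a *: tnth alpha k) = c i x - a * (i == k)%:R.
Proof.
by rewrite /c linearB linearZ /= (tnth_nth 0) coord_free // eq_sym.
Qed.

Let c_int x : x \in D -> exists k : 'I_n.+1 -> int,
  (forall i, c i x = (k i)%:~R) /\ ((forall i, 0 <= k i) \/ (forall i, k i <= 0)).
Proof.
case: hA => -[_ _ h] _ /h[k [xk hk]]; exists k; split=> // i.
rewrite /c xk linear_sum /= (bigD1 i) //= big1 ?addr0 => [|j nji].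
  by rewrite raddfMz /= (tnth_nth 0) coord_free // eqxx.
by rewrite raddfMz /= (tnth_nth 0) coord_free // (negPf nji) mul0rz.
Qed.

Let c_sign x : x \in D -> (forall i, 0 <= c i x) \/ (forall i, c i x <= 0).
Proof.
case/c_int => k [ck [hk|hk]]; [left | right] => i; by rewrite ck ?ler0z ?lerz0.
Qed.

(** Descent on the height, bounded by [h]. A positive root has a positive product with some simple
    root of its support. If another simple root occurs in it, the reflection is a positive root of
    smaller height, and [Phi] is stable under simple reflections. Otherwise it is a multiple of a
    simple root, hence equal to it. *)
Let Phi_pos (h : nat) x : x \in D -> (forall i, 0 <= c i x) -> \sum_i c i x <= h%:R ->
  x \in Phi.
Proof.
elim: h x => [|h IH] x xD x0 xh.
  have c0 i : c i x = 0.
    have /eqP : \sum_i c i x = 0 by apply/eqP; rewrite eq_le xh sumr_ge0.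
    by rewrite psumr_eq0 // => /allP /(_ i (mem_index_enum i)) /eqP.
  have := root_neq0 hD xD; rewrite [x]c_sum big1 ?eqxx // => i _.
  by rewrite c0 scale0r.
have [i /andP[ci di]] : exists i, (0 < c i x) && (0 < dot (tnth alpha i) x).
  apply/existsP; apply: contraT => /existsPn hn.
  have := root_norm_gt0 hD xD; rewrite {1}[x]c_sum dot_suml ltNge sumr_le0 // => i _.
  have := hn i; rewrite dotZl negb_and -!leNgt => /orP[ci|di].
    by rewrite (le_anti (_ : c i x <= 0 <= c i x)) ?ci ?x0 // mul0r.
  by rewrite mulr_ge0_le0.
have aD : tnth alpha i \in D by case: hA => -[sub _ _] _; apply: sub; exact: mem_tnth.
have [z hz] := rs_integral hD aD xD.
have z1 : 1 <= z%:~R :> R.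
  rewrite ler1z -gtz0_ge1 -(ltr0z R) -hz /cartan divr_gt0 ?(root_norm_gt0 hD) //.
  by rewrite dotC mulr_gt0.
have yD := rs_reflection hD aD xD.
have cy j : c j (reflection (tnth alpha i) x) = c j x - z%:~R * (i == j)%:R.
  by rewrite /reflection hz cZB eq_sym.
have stable : reflection (tnth alpha i) x \in Phi -> x \in Phi.
  by move/(Phi_reflection i); rewrite reflectionK // (root_neq0 hD).
have [/existsP[j /andP[nji cj]]|nex] := boolP [exists j, (j != i) && (0 < c j x)].
  apply: stable; apply: IH => //.
    have [//|neg] := c_sign yD; have := neg j.
    by rewrite cy eq_sym (negPf nji) mulr0 subr0 leNgt cj.
  under eq_bigr do rewrite cy; rewrite sumrB -mulr_sumr.
  rewrite sum_eq_natr.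
  by move: xh; rewrite mulr1 -natr1; lra.
have xE : x = c i x *: tnth alpha i.
  rewrite {1}[x]c_sum (bigD1 i) //= big1 ?addr0 // => j nji.
  have := existsPn nex j; rewrite nji /= -leNgt => cj.
  by rewrite (le_anti (_ : c j x <= 0 <= c j x)) ?cj ?x0 // scale0r.
have := xD; rewrite xE => /(rs_reduced hD aD)[] e; rewrite e.
  by rewrite scale1r alE; exact: (full_frame_in Phi_frame).
by move: ci; rewrite e ltr0N1.
Qed.

Lemma full_frame_typeA : exists q, full_frame D q (fun i => - beta alpha i).
Proof.
exists q; suff -> : D = Phi by exact: Phi_frame.
have PhiD x : x \in Phi -> x \in D by case/(ff_mem Phi_frame) => [i [j [/E_sub[? _] ->]]].
have PhiN x : - x \in Phi -> x \in Phi.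
  case/(ff_mem Phi_frame) => [i [j [nij e]]].
  by rewrite -[x]opprK e opprB (full_frame_in Phi_frame) // eq_sym.
apply/fsetP => x; apply/idP/idP => [xD|/PhiD//].
have bnd y : y \in D -> exists h : nat, \sum_i c i y <= h%:R.
  case/c_int => k [ck _]; exists `|(\sum_i k i)%R|%N.
  rewrite (eq_bigr _ (fun i _ => ck i)) -rmorph_sum /= natr_absz ler_int.
  exact: ler_norm.
have [pos|neg] := c_sign xD.
  by have [h hh] := bnd x xD; exact: Phi_pos hh.
apply: PhiN; have nxD := root_opp hD xD; have [h hh] := bnd (- x) nxD.
apply: Phi_pos hh => //; by move=> i; rewrite /c linearN oppr_ge0; exact: neg.
Qed.

End TypeAFrame.

(** * Weyl group and equivalence *)

Section Weyl.

Variables (R : rcfType) (r : nat) (D : {fset 'rV[R]_r}).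
Hypothesis hD : root_system D.
Implicit Types (w : 'rV[R]_r -> 'rV[R]_r).

Lemma weyl_id : weyl D id.
Proof. by exists [::]. Qed.

Lemma weyl_comp w1 w2 : weyl D w1 -> weyl D w2 -> weyl D (w1 \o w2).
Proof.
move=> [s1 [h1 e1]] [s2 [h2 e2]]; exists (s1 ++ s2); split.
  by move=> x; rewrite mem_cat => /orP[/h1|/h2].
by move=> x; rewrite foldr_cat /= e1 e2.
Qed.

Lemma weyl_reflection a : a \in D -> weyl D (reflection a).
Proof. by move=> aD; exists [:: a]; split=> // x; rewrite inE => /eqP ->. Qed.

Lemma weylZ w c x : weyl D w -> w (c *: x) = c *: w x.
Proof.
by case=> s [_ e]; rewrite !e; elim: s {e} => //= a s ->; rewrite reflectionZ.
Qed.

Lemma weyl_inv w : weyl D w -> exists w', [/\ weyl D w', cancel w w' & cancel w' w].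
Proof.
case=> s; elim: s w => [|a s IH] w [hs e].
  by exists id; split; [exact: weyl_id | move=> x; rewrite e | move=> x; rewrite e].
have aD : a \in D by apply: hs; exact: mem_head.
have [|w' [hw' c1 c2]] := IH (fun x => foldr (@reflection R r) x s).
  by split=> // x xs; apply: hs; rewrite inE xs orbT.
have inv := reflectionK (root_neq0 hD aD).
exists (w' \o reflection a); split.
- by apply: weyl_comp hw' _; exact: weyl_reflection.
- by move=> x; rewrite /= e /= inv c1.
- by move=> x; rewrite /= e /= c2 inv.
Qed.

(** The reflections in the roots act as transpositions of the indices, which generate all
    permutations. *)
Lemma weyl_perm (q : R) (n : nat) (E : 'I_n.+1 -> 'rV[R]_r) (s : 'S_n.+1) :
  full_frame D q E ->
  exists w, weyl D w /\ forall i j, w (E i - E j) = E (s i) - E (s j).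
Proof.
move=> hE; have [ts -> hts] := prod_tpermP s; elim: ts hts => [_|t ts IH /andP[ht hts]].
  by rewrite big_nil; exists id; split; [exact: weyl_id | move=> i j; rewrite !perm1].
have [w [hw we]] := IH hts; exists (w \o reflection (E t.1 - E t.2)); split.
  by apply: weyl_comp hw _; apply: weyl_reflection; exact: (full_frame_in hE).
by move=> i j; rewrite /= (full_frame_reflection _ _ hE) // we big_cons !permM.
Qed.

End Weyl.

Section Equivalence.

Variables (R : rcfType) (r : nat) (D : {fset 'rV[R]_r}).
Hypothesis hD : root_system D.

Lemma equivalent_sym m p (P : 'I_m -> {fset 'rV[R]_r}) (Q : 'I_p -> {fset 'rV[R]_r}) :
  equivalent D P Q -> equivalent D Q P.
Proof.
move=> [s [w [b [[s' ss' s's] hw h]]]]; have [w' [hw' ww' w'w]] := weyl_inv hD hw.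
exists s', w', b; split=> // [|i]; first by exists s.
have := h (s' i); rewrite s's => ->; apply/fsetP => x; apply/idP/imfsetP => /=.
  move=> xP; exists ((-1) ^+ b *: w x); first by apply/imfsetP; exists x.
  by rewrite (weylZ _ _ hw') ww' scalerA -expr2 sqrr_sign scale1r.
case=> _ /imfsetP[y /= yP ->] ->.
by rewrite (weylZ _ _ hw') ww' scalerA -expr2 sqrr_sign scale1r.
Qed.

Lemma equivalent_trans m p t (P : 'I_m -> {fset 'rV[R]_r})
    (Q : 'I_p -> {fset 'rV[R]_r}) (S : 'I_t -> {fset 'rV[R]_r}) :
  equivalent D P Q -> equivalent D Q S -> equivalent D P S.
Proof.
move=> [s1 [w1 [b1 [bs1 hw1 h1]]]] [s2 [w2 [b2 [bs2 hw2 h2]]]].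
exists (s2 \o s1), (w2 \o w1), (b2 (+) b1); split=> [||i].
- exact: bij_comp.
- exact: weyl_comp.
rewrite /= h2 h1; apply/fsetP => x; apply/imfsetP/imfsetP => /= -[y].
  case/imfsetP => /= z zP -> ->; exists z => //.
  by rewrite (weylZ _ _ hw2) scalerA signr_addb.
move=> yP ->; exists ((-1) ^+ b1 *: w1 y); first by apply/imfsetP; exists y.
by rewrite (weylZ _ _ hw2) scalerA signr_addb.
Qed.

Lemma equivalent_card m p (P : 'I_m -> {fset 'rV[R]_r}) (Q : 'I_p -> {fset 'rV[R]_r}) :
  equivalent D P Q ->
  perm_eq [seq #|` P k| | k <- enum 'I_m] [seq #|` Q k| | k <- enum 'I_p].
Proof.
move=> [s [w [b [bs hw h]]]]; have [w' [_ ww' _]] := weyl_inv hD hw.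
have pe : perm_eq [seq s k | k <- enum 'I_m] (enum 'I_p).
  apply: uniq_perm; rewrite ?enum_uniq ?(map_inj_uniq (bij_inj bs)) ?enum_uniq //.
  have [s' _ s's] := bs.
  by move=> k; rewrite mem_enum -[k]s's map_f // mem_enum.
have := perm_map (fun k => #|` Q k|) pe; rewrite -map_comp; apply: perm_trans.
rewrite (@eq_map _ _ _ (fun k => #|` P k|)) // => k /=.
rewrite h card_imfset //= => x y /(can_inj (signrZK b)).
exact: (can_inj ww').
Qed.

End Equivalence.

(** * Regular partitions as unions of rows *)

Definition is_rows (R : rcfType) (r n m : nat) (E : 'I_n.+1 -> 'rV[R]_r)
    (f : 'I_n.+1 -> 'I_m) (P : 'I_m -> {fset 'rV[R]_r}) : Prop :=
  forall k x, x \in P k <-> exists i j, [/\ i != j, f i = k & x = E i - E j].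

Lemma is_rows_max_part (R : rcfType) (r n : nat) (alpha : n.-tuple 'rV[R]_r) :
  is_rows (fun i => - beta alpha i) id (max_part alpha).
Proof.
move=> k x; split=> [/imfsetP[j /= nj ->]|[i [j [nij <- ->]]]].
  by exists k, j; rewrite opprK eq_sym.
by rewrite opprK; apply/imfsetP; exists j; rewrite //= inE eq_sym.
Qed.

Lemma is_rows_combine (R : rcfType) (r n m : nat) (E : 'I_n.+1 -> 'rV[R]_r)
    (f : 'I_n.+1 -> 'I_m) P : is_rows E id P -> is_rows E f (combine f P).
Proof.
move=> hP k x; split=> [/bigfcupP[i /andP[_ /eqP fi] /hP[i' [j [nij ei ->]]]]|].
  by move: ei nij => /= -> nij; exists i, j.
move=> [i [j [nij fi ->]]]; apply/bigfcupP; exists i.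
  by rewrite mem_enum fi eqxx.
by apply/hP; exists i, j.
Qed.

Lemma rows_surj_leq n m (f : 'I_n -> 'I_m) : (forall k, exists i, f i = k) -> (m <= n)%N.
Proof.
move=> fs; rewrite -[m]card_ord -[n]card_ord.
apply: leq_trans (leq_image_card f _); apply: subset_leq_card.
by apply/subsetP => k _; have [i <-] := fs k; exact: codom_f.
Qed.

Section Rows.

Variables (R : rcfType) (r : nat) (D : {fset 'rV[R]_r}) (q : R) (n : nat).
Variable E : 'I_n.+1 -> 'rV[R]_r.
Hypothesis hE : full_frame D q E.

(** By [full_frame_rule] the first index of a sum is that of a summand, so the sum stays in one of
    the two parts. *)
Lemma rows_regular m (f : 'I_n.+1 -> 'I_m) (P : 'I_m -> {fset 'rV[R]_r}) :
  (1 <= n)%N -> (forall k, exists i, f i = k) -> is_rows E f P -> regular D P.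
Proof.
move=> n1 fs hP.
have rule k l a b : a \in P k -> b \in P l -> a + b \in D ->
    a + b \in P k \/ a + b \in P l.
  move=> /hP[i1 [j1 [_ fi1 ->]]] /hP[i2 [j2 [_ fi2 ->]]] /(ff_mem hE)[i [j [nij e]]].
  have [ei|ei] := full_frame_rule hE nij e; [left|right]; apply/hP.
    by exists i, j; rewrite ei in nij e *.
  by exists i, j; rewrite ei in nij e *.
split.
- move=> x; split=> [/(ff_mem hE)[i [j [nij ->]]]|[k /hP[i [j [nij _ ->]]]]].
    by exists (f i); apply/hP; exists i, j.
  exact: (full_frame_in hE).
- move=> i j nij; apply/fdisjointP => x /hP[a [b [nab fa ->]]].
  apply/negP => /hP[a' [b' [_ fa' /(full_frame_inj hE nab)[ea _]]]].
  by rewrite -fa -fa' ea eqxx in nij.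
- move=> k; have [i fi] := fs k.
  have [j nij] : exists j, i != j.
    have [->|] := eqVneq i ord0; last by exists ord0.
    by exists ord_max; rewrite -val_eqE /= eq_sym -lt0n.
  by apply/fset0Pn; exists (E i - E j); apply/hP; exists i, j.
- by move=> k a b aP bP abD; case: (rule k k a b).
- move=> k l nkl a b; rewrite !in_fsetU => aP bP abD.
  case/orP: aP => aP; case/orP: bP => bP.
  + by case: (rule _ _ _ _ aP bP abD) => ->.
  + by case: (rule _ _ _ _ aP bP abD) => ->; rewrite ?orbT.
  + by case: (rule _ _ _ _ aP bP abD) => ->; rewrite ?orbT.
  + by case: (rule _ _ _ _ aP bP abD) => ->; rewrite ?orbT.
Qed.

(** Each index contributes a row of [n] distinct roots. The sizes of the parts thus determine the
    sizes of the fibres of [f]. *)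
Lemma rows_card m (f : 'I_n.+1 -> 'I_m) P k : is_rows E f P ->
  #|` P k| = (n * #|[set i | f i == k]|)%N.
Proof.
move=> hP.
have -> : P k = [fset E p.1 - E p.2 | p in
    [pred p : 'I_n.+1 * 'I_n.+1 | (f p.1 == k) && (p.1 != p.2)]].
  apply/fsetP => x; apply/idP/imfsetP => [/hP[i [j [nij fi ->]]]|[[i j] /= /andP[/eqP fi nij] ->]].
    by exists (i, j); rewrite // unfold_in /= fi eqxx.
  by apply/hP; exists i, j.
rewrite card_in_imfset /=; last first.
  move=> [i j] [i' j'] /andP[_ /= nij] _ /= /(full_frame_inj hE nij)[-> ->] //.
transitivity (\sum_(i | f i == k) \sum_(j | i != j) 1)%N.
  by rewrite -cardE -sum1_card pair_big_dep; apply: eq_bigl.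
rewrite mulnC -sum_nat_const; apply: eq_big => [i|i _]; first by rewrite inE.
rewrite sum1_card (eq_card (B := predC1 i)) ?cardC1 ?card_ord // => j.
by rewrite !inE eq_sym.
Qed.

Lemma full_frame_sign (b : bool) : full_frame D q (fun i => (-1) ^+ b *: E i).
Proof.
have sgn i j : (-1) ^+ b *: E i - (-1) ^+ b *: E j = (-1) ^+ b *: (E i - E j).
  by rewrite scalerBr.
split=> [|x|i j nij]; first exact: (ff_pos hE); last first.
  by rewrite sgn dotZl dotZr mulrA -expr2 sqrr_sign mul1r (ff_norm hE).
case: b sgn => sgn; last first.
  by rewrite (ff_mem hE); split=> -[i [j [nij ->]]]; exists i, j; rewrite sgn scale1r.
by rewrite (ff_mem (full_frame_opp hE)); split=> -[i [j [nij ->]]]; exists i, j;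
  rewrite sgn scaleN1r opprB opprK addrC.
Qed.

(** Swapping roots turns the rows of [E] with sign [b] into rows of [E]; the permutation [s] of the
    indices is realised by [w] and induces the re-numbering [t]. *)
Lemma equivalent_rows m p (P : 'I_m -> {fset 'rV[R]_r}) (Q : 'I_p -> {fset 'rV[R]_r})
    (f : 'I_n.+1 -> 'I_m) (g : 'I_n.+1 -> 'I_p) (t : 'I_m -> 'I_p)
    (s : 'I_n.+1 -> 'I_n.+1) (b : bool) (w : 'rV[R]_r -> 'rV[R]_r) :
  is_rows (fun i => (-1) ^+ b *: E i) f P -> is_rows E g Q ->
  bijective t -> bijective s -> (forall i, g (s i) = t (f i)) ->
  weyl D w -> (forall i j, w (E i - E j) = E (s i) - E (s j)) ->
  equivalent D P Q.
Proof.
move=> hP hQ bt bs gs hw wE; exists t, w, b; split=> // k.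
have ww i j : (-1) ^+ b *: w ((-1) ^+ b *: E i - (-1) ^+ b *: E j) = E (s i) - E (s j).
  by rewrite -scalerBr (weylZ _ _ hw) scalerA -expr2 sqrr_sign scale1r wE.
apply/fsetP => x; apply/idP/imfsetP => [/hQ[i [j [nij gi ->]]]|[_ /= /hP[i [j [nij fi ->]]] ->]].
  have [s' ss' s's] := bs.
  exists ((-1) ^+ b *: E (s' i) - (-1) ^+ b *: E (s' j)) => /=; last by rewrite ww !s's.
  apply/hP; exists (s' i), (s' j); split=> //; first by rewrite (can_eq s's).
  by apply: (bij_inj bt); rewrite -gs s's.
rewrite ww; apply/hQ; exists (s i), (s j); split=> //; last by rewrite gs fi.
by rewrite (bij_eq bs).
Qed.

End Rows.

Lemma regular_full_frame (R : rcfType) (r : nat) (D : {fset 'rV[R]_r}) m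
    (P : 'I_m -> {fset 'rV[R]_r}) :
  root_system D -> irreducible D -> (3 <= m)%N -> regular D P ->
  exists (n : nat) (q : R) (E : 'I_n.+1 -> 'rV[R]_r) (f : 'I_n.+1 -> 'I_m),
    [/\ (2 <= n)%N, full_frame D q E, forall k, exists i, f i = k & is_rows E f P].
Proof.
case: m P => // m P hD hirr m3 [cov dis ne cl1 cl2].
(* The default colour concerns only vectors outside [D], since the parts cover [D]. *)
pose col x := odflt ord0 [pick i | x \in P i].
have colE x k : x \in P k -> col x = k.
  rewrite /col; case: pickP => [i xi|nx] xk; last by rewrite nx in xk.
  apply/eqP; apply: contraT => /dis /fdisjointP /(_ x xi); by rewrite xk.
have colP x : x \in D -> x \in P (col x).
  by move=> /cov[k xk]; rewrite (colE x k).
have hcol x y : x \in D -> y \in D -> x + y \in D ->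
    col (x + y) = col x \/ col (x + y) = col y.
  move=> /colP xP /colP yP xyD; have [e|n] := eqVneq (col x) (col y).
    by left; apply: colE; apply: cl1 => //; rewrite e.
  have := cl2 _ _ n x y; rewrite !in_fsetU xP yP orbT => /(_ isT isT xyD).
  by case/orP => /colE ->; [left | right].
have pt (k : 'I_m.+1) : exists x, x \in D /\ col x = k.
  have /fset0Pn[x xk] := ne k; exists x; split; last exact: colE.
  by apply/cov; exists k.
have [z1 [z1D c1]] := pt (inord 0); have [z2 [z2D c2]] := pt (inord 1).
have [z3 [z3D c3]] := pt (inord 2).
have [||| n [q [E [f [n2 hE hf]]]]] := colouring_full_frame hD hirr hcol z1D z2D z3D.
1-3: by rewrite ?c1 ?c2 ?c3 inord_eq //; lia.
have hrows : is_rows E f P.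
  move=> k x; split=> [xk|[i [j [nij <- ->]]]].
    have xD : x \in D by apply/cov; exists k.
    have [i [j [nij e]]] := (ff_mem hE x).1 xD.
    by exists i, j; split=> //; rewrite -(hf i j nij) -e; exact: colE.
  by rewrite -(hf i j nij); apply: colP; exact: (full_frame_in hE).
exists n, q, E, f; split=> // k.
by have [x /hrows[i [_ [_ fi _]]]] := fset0Pn _ (ne k); exists i.
Qed.

(** The family produced by the partition is compared with the given one through [full_frame_unique],
    which supplies the sign and the re-indexing. *)
Lemma regular_rows (R : rcfType) (r : nat) (D : {fset 'rV[R]_r}) (q : R) (n : nat)
    (E : 'I_n.+1 -> 'rV[R]_r) m (P : 'I_m -> {fset 'rV[R]_r}) :
  full_frame D q E ->
  root_system D -> irreducible D -> (3 <= m)%N -> regular D P ->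
  exists (b : bool) (f : 'I_n.+1 -> 'I_m), (forall k, exists i, f i = k) /\
    is_rows (fun i => (-1) ^+ b *: E i) f P.
Proof.
move=> hE hD hirr m3 hP.
have [N [q' [e [c [N2 he cs hc]]]]] := regular_full_frame hD hirr m3 hP.
have [b [s [[s' ss' s's] hs]]] := full_frame_unique he N2 hE.
exists b, (c \o s'); split=> [k|k x].
  by have [i <-] := cs k; exists (s i); rewrite /= ss'.
split=> [/hc[i [j [nij ci ->]]]|[i [j [nij ci ->]]]].
  exists (s i), (s j); rewrite /= (can_eq ss') ss'; split=> //.
  by rewrite hs scalerBr.
apply/hc; exists (s' i), (s' j); split=> //; first by rewrite (can_eq s's).
by rewrite hs !s's scalerBr.
Qed.

(** * Fibre sizes and integer partitions *)

Definition fibre_sizes n m (f : 'I_n -> 'I_m) : seq nat :=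
  [seq #|[set i | f i == k]| | k <- enum 'I_m].

Lemma fibre_sizesE n m (f : 'I_n -> 'I_m) k :
  #|[set i | f i == k]| = count_mem k [seq f i | i <- enum 'I_n].
Proof.
rewrite count_map -sum1_card -sum1_count big_enum_cond /=.
by apply: eq_bigl => i; rewrite inE.
Qed.

Lemma perm_eq_relabel (T : eqType) n (F G : 'I_n -> T) :
  perm_eq [seq F i | i <- enum 'I_n] [seq G i | i <- enum 'I_n] ->
  exists s : 'S_n, forall i, F i = G (s i).
Proof.
move=> pe; have /tuple_permP[s e] : perm_eq [seq F i | i <- enum 'I_n] [tuple G i | i < n].
  by [].
have /eq_in_map h : [seq F i | i <- enum 'I_n] =
    [seq tnth [tuple G j | j < n] (s i) | i <- enum 'I_n] by [].
by exists s => i; rewrite h ?mem_enum // tnth_mktuple.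
Qed.

Lemma sumn_fibre_sizes n m (f : 'I_n -> 'I_m) : sumn (fibre_sizes f) = n.
Proof.
rewrite sumnE big_map big_enum /= -[RHS]card_ord -sum1_card.
rewrite (partition_big f xpredT) //=; apply: eq_bigr => k _.
by rewrite -sum1_card; apply: eq_bigl => i; rewrite inE.
Qed.

(** Sending a part of [Q] to a part of [P] containing it is surjective: a root in a given part of
    [P] lies in some part of [Q]. *)
Lemma refines_leq (R : rcfType) (r : nat) (D : {fset 'rV[R]_r}) m p
    (P : 'I_m -> {fset 'rV[R]_r}) (Q : 'I_p -> {fset 'rV[R]_r}) :
  regular D P -> regular D Q -> refines Q P -> (m <= p)%N.
Proof.
move=> hP hQ /fin_all_exists[h hh]; apply: (@rows_surj_leq p m h) => i.
have /fset0Pn[x xi] := reg_nonempty hP i.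
have /(reg_cover hQ)[k xk] : x \in D by apply/(reg_cover hP); exists i.
exists k; apply/eqP; apply: contraT => /(reg_disjoint hP) /fdisjointP /(_ x).
by rewrite xi => /(_ (fsubsetP (hh k) x xk)).
Qed.

(** The map reads off the word in which each letter [k] is repeated as often as the entry of index
    [k] prescribes. *)
Lemma exists_fibres m N (lambda : seq nat) : size lambda = m -> sumn lambda = N ->
  exists f : 'I_N -> 'I_m, fibre_sizes f = lambda.
Proof.
move=> sz sm; pose s : seq 'I_m := flatten [seq nseq (nth 0%N lambda (val k)) k | k : 'I_m <- enum 'I_m].
have lamE : [seq nth 0%N lambda (val k) | k : 'I_m <- enum 'I_m] = lambda.
  by rewrite (map_comp (nth 0%N lambda) val) val_enum_ord -sz -/(mkseq _ _) mkseq_nth.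
have ss : size s == N.
  rewrite size_flatten /shape -map_comp (@eq_map _ _ _ (fun k : 'I_m => nth 0%N lambda k)).
    by rewrite lamE sm.
  by move=> k /=; rewrite size_nseq.
exists (tnth (Tuple ss)); rewrite -[RHS]lamE; apply: eq_map => k.
rewrite fibre_sizesE map_tnth_enum /= count_flatten -map_comp sumnE big_map big_enum /=.
rewrite (bigD1 k) //= count_nseq /= eqxx mul1n big1 ?addn0 // => i /negPf ni.
by rewrite count_nseq /= ni.
Qed.
Section Shapes.

Variables (R : rcfType) (r : nat) (D : {fset 'rV[R]_r}) (q : R) (n : nat).
Variables (E : 'I_n.+1 -> 'rV[R]_r) (M : 'I_n.+1 -> {fset 'rV[R]_r}).
Hypotheses (hD : root_system D) (hE : full_frame D q E) (hM : is_rows E id M).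
Hypothesis n_gt0 : (0 < n)%N.

Lemma equivalent_fibre_sizes m p (f : 'I_n.+1 -> 'I_m) (g : 'I_n.+1 -> 'I_p) :
  equivalent D (combine f M) (combine g M) -> perm_eq (fibre_sizes f) (fibre_sizes g).
Proof.
move=> /(equivalent_card hD).
rewrite !(eq_map (fun k => rows_card hE k (is_rows_combine _ hM))).
rewrite (map_comp (muln n)) [X in perm_eq _ X](map_comp (muln n)).
by apply: perm_map_inj => x y /eqP; rewrite eqn_pmul2l // => /eqP.
Qed.

(** A re-numbering [t] of the parts first matches the fibre sizes. The words of [t] composed with
    [f] and of [g] then contain each letter equally often, so a permutation of the indices carries
    one to the other, and [weyl_perm] realises it. *)
Lemma fibre_sizes_equivalent m (f g : 'I_n.+1 -> 'I_m) :
  perm_eq (fibre_sizes f) (fibre_sizes g) -> equivalent D (combine f M) (combine g M).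
Proof.
move=> /perm_eq_relabel[t ht].
have : perm_eq [seq t (f i) | i <- enum 'I_n.+1] [seq g i | i <- enum 'I_n.+1].
  rewrite (map_comp t f); apply/allP => k _; apply/eqP.
  have e : preim t (pred1 (t (t^-1%g k))) =1 pred1 (t^-1%g k).
    by move=> i /=; rewrite (inj_eq perm_inj).
  by rewrite -[k](permKV t) count_map (eq_count e) -!fibre_sizesE ht.
case/perm_eq_relabel => s hs; have [w [hw wE]] := weyl_perm s hE.
have hP : is_rows (fun i => (-1) ^+ false *: E i) f (combine f M).
  move=> k x; rewrite (is_rows_combine f hM).
  by split=> -[i [j [nij fi ->]]]; exists i, j; rewrite !scale1r.
have bt : bijective t by exists (t^-1%g); [exact: permK | exact: permKV].
have bs : bijective s by exists (s^-1%g); [exact: permK | exact: permKV].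
exact: (equivalent_rows hP (is_rows_combine g hM) bt bs (fun i => esym (hs i)) hw wE).
Qed.

Lemma regular_equivalent_combine m (P : 'I_m -> {fset 'rV[R]_r}) (b : bool)
    (f : 'I_n.+1 -> 'I_m) :
  is_rows (fun i => (-1) ^+ b *: E i) f P -> equivalent D P (combine f M).
Proof.
move=> hP; apply: (equivalent_rows hP (is_rows_combine f hM) (t := id) (s := id) (w := id)) => //.
- by exists id.
- by exists id.
- exact: weyl_id.
Qed.

Lemma regular_equivalent_max (P : 'I_n.+1 -> {fset 'rV[R]_r}) (b : bool) f :
  (forall k, exists i, f i = k) -> is_rows (fun i => (-1) ^+ b *: E i) f P ->
  equivalent D P M.
Proof.
move=> /fin_all_exists[g fg] hP.
(* A section of a map of a finite set to itself is a two-sided inverse. *)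
have gf : cancel f g by apply: canF_sym => x; exact: fg.
apply: (equivalent_rows hP hM (t := g) (s := id) (w := id)) => //.
- by exists f.
- by exists id.
- exact: weyl_id.
Qed.

End Shapes.

Theorem theoremA (R : rcfType) (r : nat) (D : {fset 'rV[R]_r})
    (hD : root_system D) (hirr : irreducible D) :
  (* 1 *)
  (forall (m : nat) (P : 'I_m -> {fset 'rV[R]_r}),
     (3 <= m)%N -> regular D P ->
     exists n : nat, (2 <= n)%N /\ of_typeA D n) /\
  (forall (n : nat) (alpha : n.-tuple 'rV[R]_r),
     (2 <= n)%N -> typeA_base D alpha ->
     (* 2 *)
     [/\ maximal_regular D (max_part alpha),
         forall P : 'I_n.+1 -> {fset 'rV[R]_r},
           regular D P -> equivalent D P (max_part alpha),
         forall (m : nat) (P : 'I_m -> {fset 'rV[R]_r}),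
           (3 <= m)%N -> regular D P -> (m <= n.+1)%N
       & forall (m : nat) (P : 'I_m -> {fset 'rV[R]_r}),
           (3 <= m)%N -> maximal_regular D P ->
           equivalent D P (max_part alpha)] /\
     (* 3 *)
     (forall (m : nat) (P : 'I_m -> {fset 'rV[R]_r}),
        (3 <= m)%N -> (m < n.+1)%N -> regular D P ->
        exists f : 'I_n.+1 -> 'I_m,
          (forall k, exists i, f i = k) /\
          equivalent D P (combine f (max_part alpha))) /\
     (* 4 *)
     (forall m : nat, (3 <= m)%N ->
        [/\ forall P : 'I_m -> {fset 'rV[R]_r}, regular D P ->
              exists! lambda : seq nat,
                int_partition m n.+1 lambda /\ has_shape D alpha P lambda,
            forall lambda : seq nat, int_partition m n.+1 lambda ->
              exists P : 'I_m -> {fset 'rV[R]_r},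
                regular D P /\ has_shape D alpha P lambda
          & forall (P Q : 'I_m -> {fset 'rV[R]_r}) (lambda mu : seq nat),
              regular D P -> regular D Q ->
              int_partition m n.+1 lambda -> int_partition m n.+1 mu ->
              has_shape D alpha P lambda -> has_shape D alpha Q mu ->
              (equivalent D P Q <-> lambda = mu)])).
Proof.
split=> [m P m3 hP|n alpha n2 hA].
  have [n [q [E [f [n2 hE _ _]]]]] := regular_full_frame hD hirr m3 hP.
  exists n; split=> //; eexists; exact: typeA_full_frame hE.
case: n alpha n2 hA => // n alpha n2 hA.
have [q hE] := full_frame_typeA hD hA.
have hM := is_rows_max_part alpha.
set E := fun i => - beta alpha i in hE hM; set M := max_part alpha in hM *.
have rows m (P : 'I_m -> {fset 'rV[R]_r}) := @regular_rows _ _ _ _ _ _ m P hE hD hirr.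
have leq_m m (P : 'I_m -> {fset 'rV[R]_r}) : (3 <= m)%N -> regular D P -> (m <= n.+2)%N.
  by move=> m3 hP; have [b [f [fs _]]] := rows m P m3 hP; exact: rows_surj_leq fs.
have maxP (P : 'I_n.+2 -> {fset 'rV[R]_r}) : regular D P -> equivalent D P M.
  move=> hP; have [b [f [fs hf]]] := rows _ P n2 hP.
  exact: (regular_equivalent_max _ hM fs hf).
have regM : regular D M by apply: (rows_regular hE _ _ hM) => // k; exists k.
have combP m (P : 'I_m -> {fset 'rV[R]_r}) : (3 <= m)%N -> regular D P ->
    exists f : 'I_n.+2 -> 'I_m, (forall k, exists i, f i = k) /\
      equivalent D P (combine f M).
  move=> m3 hP; have [b [f [fs hf]]] := rows m P m3 hP.
  by exists f; split=> //; exact: (regular_equivalent_combine _ hM hf).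
have shape_eq m (P Q : 'I_m -> {fset 'rV[R]_r}) lambda mu :
    int_partition m n.+2 lambda -> int_partition m n.+2 mu ->
    has_shape D alpha P lambda -> has_shape D alpha Q mu ->
    equivalent D P Q <-> lambda = mu.
  move=> /and4P[_ sl _ _] /and4P[_ sm _ _] [f [pf ef]] [g [pg eg]].
  split=> [PQ|e].
    (* Both sequences are weakly decreasing, so agreement up to permutation suffices, and fibre
       sizes are invariant under equivalence. *)
    apply: (sorted_eq (leT := geq)) => //.
    - by move=> a b c ab bc; exact: leq_trans bc ab.
    - by move=> a b /andP[ab ba]; apply/eqP; rewrite eqn_leq; apply/andP; split.
    apply: perm_trans pf _; rewrite perm_sym; apply: perm_trans pg _; rewrite perm_sym.
    apply: (equivalent_fibre_sizes hD hE hM) => //.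
    apply: equivalent_trans (equivalent_trans PQ eg); exact: equivalent_sym.
  apply: (equivalent_trans ef).
  apply: equivalent_trans (equivalent_sym hD eg).
  apply: (fibre_sizes_equivalent hE hM).
  by rewrite perm_sym in pf; apply: perm_trans pf _; rewrite e.
split; [split|split] => //.
(* A refinement of [M] has at least [n.+2] parts, hence at least three, so [leq_m] bounds it from
   above. *)
- split=> // p Q hQ ref; apply/eqP; rewrite eqn_leq.
  have le := refines_leq regM hQ ref; rewrite le (leq_m _ Q) //.
  exact: leq_trans le.
- move=> m P m3 [hP maxm]; have [b [f [fs hf]]] := rows m P m3 hP.
  have hE' := full_frame_sign hE b.
  (* The single rows of the signed family form a regular partition refining [P], so maximality gives
     [P] exactly [n.+2] parts. *)
  pose Q i := [fset (-1) ^+ b *: E i - (-1) ^+ b *: E j | j in 'I_n.+2 & j != i].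
  have hQ : is_rows (fun i => (-1) ^+ b *: E i) id Q.
    move=> k x; split=> [/imfsetP[j /= nj ->]|[i [j [nij <- ->]]]].
      by exists k, j; rewrite eq_sym.
    by apply/imfsetP; exists j; rewrite //= inE eq_sym.
  have regQ : regular D Q by apply: (rows_regular hE' _ _ hQ) => // k; exists k.
  have em : n.+2 = m.
    apply: maxm regQ _ => k; exists (f k); apply/fsubsetP => x /hQ[i [j [nij <- ->]]].
    by apply/hf; exists i, j.
  by subst m; exact: maxP.
- by move=> m P m3 _; exact: combP.
move=> m m3; split=> [P hP|lambda hl|P Q lambda mu _ _]; last exact: shape_eq.
- have [f [fs ef]] := combP m P m3 hP.
  have hs : int_partition m n.+2 (sort geq (fibre_sizes f)).
    apply/and4P; split.
    + by rewrite size_sort size_map size_enum_ord.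
    + by apply: sort_sorted => a b; exact: leq_total.
    + rewrite all_sort; apply/allP => _ /mapP[k _ ->]; apply/card_gt0P.
      by have [i fi] := fs k; exists i; rewrite inE fi.
    + by rewrite (perm_sumn (_ : perm_eq _ (fibre_sizes f))) ?perm_sort // sumn_fibre_sizes eqxx.
  have sh : has_shape D alpha P (sort geq (fibre_sizes f)).
    by exists f; rewrite perm_sort.
  exists (sort geq (fibre_sizes f)); split=> // mu [hmu smu].
  apply/(shape_eq m P P _ _ hs hmu sh smu).
  (* Uniqueness of the shape is its invariance applied to [P] and itself. *)
  exact: (equivalent_trans ef (equivalent_sym hD ef)).
have /and4P[/eqP sl _ pl /eqP suml] := hl.
have [f hf] := exists_fibres sl suml.
exists (combine f M); split; last first.
  exists f; split; first by rewrite -/(fibre_sizes f) hf.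
  by apply: (fibre_sizes_equivalent hE hM).
apply: (rows_regular hE _ _ (is_rows_combine f hM)) => // k.
have : (0 < #|[set i | f i == k]|)%N.
  by apply: (allP pl); rewrite -hf; apply: map_f; rewrite mem_enum.
by case/card_gt0P => i; rewrite inE => /eqP fi; exists i.
Qed.
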